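(* Suppose that $\mathcal M\models\mathsf{PA}$, $\mathcal M$ is countably generated over the cut $I$ of $\mathcal M$, $\operatorname{Cod}(\mathcal M/I)\subseteq\mathfrak X\subseteq\mathcal P(I)$, and $\mathcal M$ has a countably generated $\mathfrak X$-extension. The following are equivalent: (1) $\Delta^0_2\text{-}\operatorname{Def}(\mathcal M|I,\operatorname{Cod}(\mathcal M/I))\subseteq\mathfrak X$. (2) There is a countably generated, filling extension $\mathcal N\succ_{\sf cf}\mathcal M$ such that $\operatorname{GCIS}(\mathcal M,\mathcal N)=I$ and $\operatorname{Cod}(\mathcal N/I)=\mathfrak X$. (3) There is an extension $\mathcal N\succ_{\sf cf}\mathcal M$ such that $\operatorname{Cod}(\mathcal N/I)=\mathfrak X$ and $\mathcal N$ is generated over $\mathcal M$ by an element filling $I$.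
   Context: $\mathsf{PA}$ is Peano Arithmetic in the language $\{+,\times,0,1,\le\}$; structures $\mathcal M,\mathcal N,\dots$ have universes $M,N,\dots$. $\mathcal N\succ\mathcal M$ means $\mathcal N$ is a proper elementary extension of $\mathcal M$; $\mathcal N\succ_{\sf cf}\mathcal M$ means in addition that $M$ is cofinal in $\mathcal N$. $\operatorname{Def}(\mathcal M)$ is the set of subsets of $M$ definable in $\mathcal M$ with parameters; for $X\subseteq M$, $\operatorname{Cod}(\mathcal M/X)=\{X\cap D: D\in\operatorname{Def}(\mathcal M)\}$. A cut $I$ of $\mathcal M$ is a nonempty proper subset of $M$ such that $a\in I$ whenever $b\in I$ and $a\le b+1$. $\mathcal M|I$ is the substructure of $\mathcal M$ with universe $I$ (when it is considered it is tacitly understood that $I$ is closed under $+$ and $\times$). A set $X\subseteq M$ generates $\mathcal M$ if there is no $\mathcal K\prec\mathcal M$ with $X\subseteq K$. $\mathcal M$ is countably generated over $I\subseteq M$ if there is a countable $X\subseteq M$ such that $X\cup I$ generates $\mathcal M$. An extension $\mathcal N\succ\mathcal M$ is countably generated if $\mathcal N$ is countably generated over $M$; it is generated over $\mathcal M$ by an element $c$ if $M\cup\{c\}$ generates $\mathcal N$. For $\mathcal M\prec\mathcal N$, $\operatorname{GCIS}(\mathcal M,\mathcal N)=\{b\in M:[0,b]^{\mathcal M}=[0,b]^{\mathcal N}\}$. An element $b\in N$ fills the cut $I$ of $\mathcal M$ if $a<b<c$ whenever $a\in I$ and $c\in M\setminus I$. An extension $\mathcal N\succ_{\sf cf}\mathcal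 M$ is filling if some $b\in N$ fills $\operatorname{GCIS}(\mathcal M,\mathcal N)$. $\mathcal N$ is an $\mathfrak X$-extension of $\mathcal M$ if $\mathcal N\succ\mathcal M\models\mathsf{PA}$ and $\mathcal M$ has a cut $I$ such that $I=\operatorname{GCIS}(\mathcal M,\mathcal N)$ and $\mathfrak X=\operatorname{Cod}(\mathcal N/I)$. For a second-order structure $(\mathcal A,\mathfrak Y)$ with $\mathfrak Y\subseteq\mathcal P(A)$, $\Sigma^0_n$ and $\Pi^0_n$ formulas have no second-order quantifiers and may have parameters from $A$ and $\mathfrak Y$ ($\Sigma^0_0=\Pi^0_0$ being the bounded ones); $\Delta^0_n\text{-}\operatorname{Def}(\mathcal A,\mathfrak Y)$ is the set of subsets of $A$ definable in $(\mathcal A,\mathfrak Y)$ both by a $\Sigma^0_n$ and by a $\Pi^0_n$ formula. *)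

(* Defs.v *)
From mathcomp Require Import all_boot.
From mathcomp Require Import boolp classical_sets functions cardinality.

Set Implicit Arguments.
Unset Strict Implicit.
Unset Printing Implicit Defensive.

Local Open Scope classical_set_scope.

Record structure := Structure {
  carrier :> Type;
  szero : carrier;
  sone : carrier;
  sadd : carrier -> carrier -> carrier;
  smul : carrier -> carrier -> carrier;
  sle : carrier -> carrier -> Prop }.

Arguments szero {s}.
Arguments sone {s}.
Arguments sadd {s} _ _.
Arguments smul {s} _ _.
Arguments sle {s} _ _.

Definition slt (M : structure) (a b : M) : Prop := sle a b /\ a <> b.

(* Variables are de Bruijn indices. *)
Inductive term :=
| Var of nat
| Zero
| One
| Add of term & term
| Mul of term & term.

Fixpoint lift (t : term) : term :=
  match t with
  | Var i => Var i.+1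
  | Zero => Zero
  | One => One
  | Add t1 t2 => Add (lift t1) (lift t2)
  | Mul t1 t2 => Mul (lift t1) (lift t2)
  end.

(* Formulas without second-order quantifiers, over the language of arithmetic
   expanded by a unary predicate symbol for each element of [S]. *)
Inductive formula (S : Type) :=
| Bot
| Eq of term & term
| Le of term & term
| Mem of S & term
| Imp of formula S & formula S
| And of formula S & formula S
| Or of formula S & formula S
| All of formula S
| Ex of formula S.

Arguments Bot {S}.
Arguments Eq {S} _ _.
Arguments Le {S} _ _.

Definition scons (T : Type) (a : T) (v : nat -> T) : nat -> T :=
  fun i => if i is j.+1 then v j else a.

Fixpoint eval (M : structure) (v : nat -> M) (t : term) : M :=
  match t with
  | Var i => v i
  | Zero => szero
  | One => sone
  | Add t1 t2 => sadd (eval v t1) (eval v t2)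
  | Mul t1 t2 => smul (eval v t1) (eval v t2)
  end.

Fixpoint sat2 (M : structure) (S : Type) (V : S -> set M) (v : nat -> M)
    (phi : formula S) : Prop :=
  match phi with
  | Bot => False
  | Eq t1 t2 => eval v t1 = eval v t2
  | Le t1 t2 => sle (eval v t1) (eval v t2)
  | Mem X t => V X (eval v t)
  | Imp p q => sat2 V v p -> sat2 V v q
  | And p q => sat2 V v p /\ sat2 V v q
  | Or p q => sat2 V v p \/ sat2 V v q
  | All p => forall a : M, sat2 V (scons a v) p
  | Ex p => exists a : M, sat2 V (scons a v) p
  end.

(* No predicate symbols: formulas of {+, *, 0, 1, <=} alone. *)
Definition fo_formula := formula void.

Definition sat (M : structure) (v : nat -> M) (phi : fo_formula) : Prop :=
  sat2 (fun s : void => match s with end) v phi.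

Record PA (M : structure) : Prop := {
  PA_succ_neq0 : forall x : M, sadd x sone <> szero;
  PA_succ_inj : forall x y : M, sadd x sone = sadd y sone -> x = y;
  PA_add0 : forall x : M, sadd x szero = x;
  PA_addS : forall x y : M, sadd x (sadd y sone) = sadd (sadd x y) sone;
  PA_mul0 : forall x : M, smul x szero = szero;
  PA_mulS : forall x y : M, smul x (sadd y sone) = sadd (smul x y) x;
  PA_le : forall x y : M, sle x y <-> exists z : M, sadd z x = y;
  PA_ind : forall (phi : fo_formula) (v : nat -> M),
    sat (scons szero v) phi ->
    (forall x : M, sat (scons x v) phi -> sat (scons (sadd x sone) v) phi) ->
    forall x : M, sat (scons x v) phi }.

(* The valuation [v] supplies the parameters. *)
Definition Def (M : structure) : set (set M) :=
  [set D | exists (phi : fo_formula) (v : nat -> M),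
             D = [set a | sat (scons a v) phi]].

Arguments Def : clear implicits.

Definition Cod (M : structure) (X : set M) : set (set M) :=
  [set X `&` D | D in Def M].

Definition elementary (M N : structure) (f : M -> N) : Prop :=
  forall (phi : fo_formula) (v : nat -> M),
    sat v phi <-> sat (fun i => f (v i)) phi.

(* An extension of M is given by an embedding f : M -> N, M being identified
   with [range f]. *)
Definition extension (M N : structure) (f : M -> N) : Prop :=
  elementary f /\ exists b : N, ~ range f b.

Definition cofinal_extension (M N : structure) (f : M -> N) : Prop :=
  extension f /\ forall b : N, exists a : M, sle b (f a).

Definition generates (M : structure) (X : set M) : Prop :=
  forall (K : structure) (g : K -> M), extension g -> ~ X `<=` range g.

Definition countably_generated_over (M : structure) (I : set M) : Prop :=
  exists X : set M, countable X /\ generates (X `|` I).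

Definition countably_generated (M N : structure) (f : M -> N) : Prop :=
  countably_generated_over (range f).

Definition generated_by (M N : structure) (f : M -> N) (c : N) : Prop :=
  generates (range f `|` [set c]).

Definition cut (M : structure) (I : set M) : Prop :=
  [/\ I !=set0, I <> setT &
      forall a b : M, I b -> sle a (sadd b sone) -> I a].

Definition initial_segment (M : structure) (b : M) : set M :=
  [set x | sle szero x /\ sle x b].

Definition GCIS (M N : structure) (f : M -> N) : set M :=
  [set b | f @` initial_segment b = initial_segment (f b)].

Definition fills (M N : structure) (f : M -> N) (I : set M) (b : N) : Prop :=
  forall a c : M, I a -> ~ I c -> slt (f a) b /\ slt b (f c).

Definition filling (M N : structure) (f : M -> N) : Prop :=
  cofinal_extension f /\ exists b : N, fills f (GCIS f) b.

(* Cod(N/I) = XX, where I and the members of XX are subsets of M and are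
   identified with their images in N. *)
Definition Cod_ext_eq (M N : structure) (f : M -> N) (I : set M)
    (XX : set (set M)) : Prop :=
  Cod (f @` I) = [set f @` X | X in XX].

Definition X_extension (M N : structure) (f : M -> N) (XX : set (set M)) :
    Prop :=
  [/\ extension f, PA M &
      exists I : set M, [/\ cut I, I = GCIS f & Cod_ext_eq f I XX]].

(* In a bounded quantifier the bound is a term not containing the quantified
   variable. *)
Inductive bounded (S : Type) : formula S -> Prop :=
| bounded_Bot : bounded Bot
| bounded_Eq t1 t2 : bounded (Eq t1 t2)
| bounded_Le t1 t2 : bounded (Le t1 t2)
| bounded_Mem X t : bounded (Mem X t)
| bounded_Imp p q : bounded p -> bounded q -> bounded (Imp p q)
| bounded_And p q : bounded p -> bounded q -> bounded (And p q)
| bounded_Or p q : bounded p -> bounded q -> bounded (Or p q)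
| bounded_All t p : bounded p -> bounded (All (Imp (Le (Var 0) (lift t)) p))
| bounded_Ex t p : bounded p -> bounded (Ex (And (Le (Var 0) (lift t)) p)).

Inductive is_Sigma (S : Type) : nat -> formula S -> Prop :=
| Sigma_bounded p : bounded p -> is_Sigma 0 p
| Sigma_Pi n p : is_Pi n p -> is_Sigma n.+1 p
| Sigma_Ex n p : is_Sigma n.+1 p -> is_Sigma n.+1 (Ex p)
with is_Pi (S : Type) : nat -> formula S -> Prop :=
| Pi_bounded p : bounded p -> is_Pi 0 p
| Pi_Sigma n p : is_Sigma n p -> is_Pi n.+1 p
| Pi_All n p : is_Pi n.+1 p -> is_Pi n.+1 (All p).

(* Set parameters from YY are the predicate symbols of the formula. *)
Definition definable2 (A : structure) (YY : set (set A))
    (P : formula {Y : set A | YY Y} -> Prop) : set (set A) :=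
  [set D | exists (phi : formula {Y : set A | YY Y}) (v : nat -> A),
             P phi /\ D = [set a | sat2 (fun Y => sval Y) (scons a v) phi]].

Definition Delta_Def (n : nat) (A : structure) (YY : set (set A)) :
    set (set A) :=
  definable2 (@is_Sigma {Y : set A | YY Y} n) `&`
  definable2 (@is_Pi {Y : set A | YY Y} n).

Definition closed_under (M : structure) (op : M -> M -> M) (I : set M) :=
  forall a b : M, I a -> I b -> I (op a b).

Lemma cut_zero (M : structure) (I : set M) : PA M -> cut I -> I szero.
Proof.
move=> pa [[b Ib] _ dn]; apply: (dn _ b Ib); apply/(PA_le pa).
by exists (sadd b sone); rewrite (PA_add0 pa).
Qed.

Lemma cut_one (M : structure) (I : set M) : PA M -> cut I -> I sone.
Proof.
move=> pa [[b Ib] _ dn]; apply: (dn _ b Ib); apply/(PA_le pa).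
by exists b.
Qed.

Definition restrict (M : structure) (I : set M) (pa : PA M) (Icut : cut I)
    (Iadd : closed_under sadd I) (Imul : closed_under smul I) : structure :=
  @Structure {x : M | I x}
    (exist I szero (cut_zero pa Icut))
    (exist I sone (cut_one pa Icut))
    (fun x y => exist I (sadd (sval x) (sval y)) (Iadd _ _ (svalP x) (svalP y)))
    (fun x y => exist I (smul (sval x) (sval y)) (Imul _ _ (svalP x) (svalP y)))
    (fun x y => sle (sval x) (sval y)).

Definition incl (M : structure) (I : set M) (pa : PA M) (Icut : cut I)
    (Iadd : closed_under sadd I) (Imul : closed_under smul I) :
    restrict pa Icut Iadd Imul -> M := fun x => sval x.

(* Delta^0_n-Def(M|I, Cod(M/I)), as a family of subsets of M. *)
Definition Delta_Def_cut (n : nat) (M : structure) (I : set M) (pa : PA M)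
    (Icut : cut I) (Iadd : closed_under sadd I) (Imul : closed_under smul I) :
    set (set M) :=
  let i := @incl M I pa Icut Iadd Imul in
  [set i @` D | D in Delta_Def n [set i @^-1` X | X in Cod I]].

(* Main.v *)
Require Import Defs.
From Stdlib Require Import Ring.
From mathcomp Require Import all_boot.
From mathcomp Require Import boolp classical_sets functions cardinality.

(** Let [N0] be the given extension: [I] is an initial segment of it, and
    the traces on [I] of its definable sets are the members of [XX]. A
    nonempty member of [XX] that is bounded in [I] therefore has a maximum,
    and overspill holds for definable sets of [N0] that contain [I].

    An element filling [I] forces closure under definability at level two.
    Suppose that [X] and its complement are given by [Ex u All z P(u, z, a)]
    and [Ex u All z P'(u, z, a)], with quantifiers over [I] and matrices
    definable in [M] and antitone in [z]. If [b] fills [I], then for [u] in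
    [I] the condition [All z P(u, z, a)] is equivalent to [P(u, b, a)]: by
    overspill in [M] it holds up to an element of [M] outside [I], which
    exceeds [b]. So [X] consists of those [a] for which a witness of [P(.,
    b, a)] comes before any witness of [P'(., b, a)], and it is coded
    ([filling_Delta2]).

    If an extension with an element filling [I] codes exactly the members
    of [XX], then it adds no element below an element of [I]: such an
    element would determine a bounded initial segment of [I] without a
    maximum, which [N0] does not code ([fills_GCIS]).

    The extension is constructed as the ultrapower of [M] by its definable
    functions, for an ultrafilter [U] of definable sets that meet [I] in
    unbounded sets. The germ of the identity generates it and fills [I], and
    by the theorem of Los the coded sets are those of the form [i |-> (V_i
    in U)], where [V_i] are the sections of a definable set. So these must
    be exactly the members of [XX]. Since [M] and [N0] are countably
    generated over [I], all definable sets of [M] are rows of countably many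
    families indexed by [I], and all members of [XX] are obtained from
    countably many ([countably_generated_Def]). Hence [U] can be built in
    countably many stages, each of which treats one whole family: its
    membership pattern in [U] must lie in [XX] ([decide]), or must be a
    prescribed member of [XX] ([encode]).

    The closure assumption on [XX] enters only through projections along
    [I] of definable sets. First, it makes [I] closed under exponentiation,
    because otherwise the exponents whose powers lie in [I] would form a
    bounded set without a maximum ([full_in_cut]); so patterns of length in [I] have
    codes in [I]. Secondly, [N0] knows which patterns of length [u] are
    realized in [I] beyond [u], and by overspill it contains a single
    pattern all of whose initial parts are realized; this is [decide]. For
    [encode], the family is chosen before the prescribed pattern is known:
    it reads off a code from a definable function that takes each value [r]
    of [I] on every class unbounded in [I] of elements with the same pattern
    of length [r] ([selector]). *)

Set Implicit Arguments.
Unset Strict Implicit.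
Unset Printing Implicit Defensive.

Local Open Scope classical_set_scope.


Lemma sval_inj (T : Type) (P : T -> Prop) (a b : {x | P x}) : sval a = sval b -> a = b.
Proof.
case: a b => [a Pa] [b Pb] /= e; case: _ / e Pb => Pb.
by congr exist; exact: Prop_irrelevance.
Qed.

(** * Renaming of variables *)

Fixpoint ren_term (r : nat -> nat) (t : term) : term :=
  match t with
  | Var i => Var (r i)
  | Zero => Zero
  | One => One
  | Add t1 t2 => Add (ren_term r t1) (ren_term r t2)
  | Mul t1 t2 => Mul (ren_term r t1) (ren_term r t2)
  end.

Definition ren_up (r : nat -> nat) : nat -> nat :=
  fun i => if i is j.+1 then (r j).+1 else 0.

Fixpoint ren (S : Type) (r : nat -> nat) (phi : formula S) : formula S :=
  match phi with
  | Bot => Bot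
  | Eq t1 t2 => Eq (ren_term r t1) (ren_term r t2)
  | Le t1 t2 => Le (ren_term r t1) (ren_term r t2)
  | Defs.Mem X t => Defs.Mem X (ren_term r t)
  | Imp p q => Imp (ren r p) (ren r q)
  | And p q => And (ren r p) (ren r q)
  | Or p q => Or (ren r p) (ren r q)
  | All p => All (ren (ren_up r) p)
  | Ex p => Ex (ren (ren_up r) p)
  end.

Lemma eval_ren (M : structure) (v : nat -> M) r t :
  eval v (ren_term r t) = eval (fun i => v (r i)) t.
Proof. by elim: t => //= t1 -> t2 ->. Qed.

Lemma sat2_ren (M : structure) (S : Type) (V : S -> set M) (v : nat -> M) r phi :
  sat2 V v (ren r phi) = sat2 V (fun i => v (r i)) phi.
Proof.
have up a w s : (fun i => scons a w (ren_up s i)) = scons a (fun i => w (s i)) :> (nat -> M).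
  by apply/funext => -[].
elim: phi v r => //=.
- by move=> t1 t2 v r; rewrite !eval_ren.
- by move=> t1 t2 v r; rewrite !eval_ren.
- by move=> X t v r; rewrite eval_ren.
- by move=> p IHp q IHq v r; rewrite IHp IHq.
- by move=> p IHp q IHq v r; rewrite IHp IHq.
- by move=> p IHp q IHq v r; rewrite IHp IHq.
- by move=> p IHp v r; apply: eq_forall => a; rewrite IHp up.
- by move=> p IHp v r; apply: eq_exists => a; rewrite IHp up.
Qed.

Lemma eval_bound t : exists k, forall (M : structure) (v w : nat -> M),
  (forall i, i < k -> v i = w i) -> eval v t = eval w t.
Proof.
elim: t => /=.
- by move=> i; exists i.+1 => M v w; apply.
- by exists 0.
- by exists 0.
- move=> t1 [k1 h1] t2 [k2 h2]; exists (maxn k1 k2) => M v w e.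
  by rewrite (h1 M v w) ?(h2 M v w) // => i ik; apply: e; rewrite leq_max ik ?orbT.
- move=> t1 [k1 h1] t2 [k2 h2]; exists (maxn k1 k2) => M v w e.
  by rewrite (h1 M v w) ?(h2 M v w) // => i ik; apply: e; rewrite leq_max ik ?orbT.
Qed.

(** Only finitely many variables matter, which makes it possible to quantify
    over all of them. *)
Lemma sat2_bound (S : Type) (phi : formula S) :
  exists k, forall (M : structure) (V : S -> set M) (v w : nat -> M),
  (forall i, i < k -> v i = w i) -> sat2 V v phi = sat2 V w phi.
Proof.
have two t1 t2 : exists k, forall (M : structure) (v w : nat -> M),
    (forall i, i < k -> v i = w i) -> eval v t1 = eval w t1 /\ eval v t2 = eval w t2.
  have [k h] := eval_bound (Add t1 t2); have [k1 h1] := eval_bound t1.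
  have [k2 h2] := eval_bound t2; exists (maxn k1 k2) => M v w e.
  by split; [apply: h1 | apply: h2] => i ik; apply: e; rewrite leq_max ik ?orbT.
have bin (o : Prop -> Prop -> Prop) (p q : formula S) :
    (exists k, forall (M : structure) (V : S -> set M) (v w : nat -> M),
      (forall i, i < k -> v i = w i) -> sat2 V v p = sat2 V w p) ->
    (exists k, forall (M : structure) (V : S -> set M) (v w : nat -> M),
      (forall i, i < k -> v i = w i) -> sat2 V v q = sat2 V w q) ->
    exists k, forall (M : structure) (V : S -> set M) (v w : nat -> M),
      (forall i, i < k -> v i = w i) ->
      o (sat2 V v p) (sat2 V v q) = o (sat2 V w p) (sat2 V w q).
  move=> [k1 h1] [k2 h2]; exists (maxn k1 k2) => M V v w e.
  by rewrite (h1 M V v w) ?(h2 M V v w) // => i ik; apply: e; rewrite leq_max ik ?orbT.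
have quant (o : forall T : Type, (T -> Prop) -> Prop) (p : formula S) :
    (exists k, forall (M : structure) (V : S -> set M) (v w : nat -> M),
      (forall i, i < k -> v i = w i) -> sat2 V v p = sat2 V w p) ->
    exists k, forall (M : structure) (V : S -> set M) (v w : nat -> M),
      (forall i, i < k -> v i = w i) ->
      o M (fun a => sat2 V (scons a v) p) = o M (fun a => sat2 V (scons a w) p).
  move=> [k h]; exists k => M V v w e; congr (o M); apply/funext => a.
  by apply: h => -[|i] //= ik; apply: e; apply: ltnW.
elim: phi => /=.
- by exists 0.
- by move=> t1 t2; have [k h] := two t1 t2; exists k => M V v w /h [-> ->].
- by move=> t1 t2; have [k h] := two t1 t2; exists k => M V v w /h [-> ->].
- by move=> X t; have [k h] := two t t; exists k => M V v w /h [-> _].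
- by move=> p hp q hq; exact: bin (fun a b => a -> b) _ _ hp hq.
- by move=> p hp q hq; exact: bin and _ _ hp hq.
- by move=> p hp q hq; exact: bin or _ _ hp hq.
- by move=> p hp; exact: quant (fun T P => forall a : T, P a) _ hp.
- by move=> p hp; exact: quant (fun T P => exists a : T, P a) _ hp.
Qed.

(** * Classes of definable predicates *)

(** Definability is treated as a property of predicates on valuations, so that
    formulas need not be written down, and in two structures at once, so that
    a definition can be moved along an embedding together with its use. *)
Definition biclass (M N : structure) :=
  ((nat -> M) -> Prop) -> ((nat -> N) -> Prop) -> Prop.

Record defclass (M N : structure) (C : biclass M N) : Prop := {
  dc_bot : C (fun _ => False) (fun _ => False);
  dc_eqt : forall t1 t2,
    C (fun v => eval v t1 = eval v t2) (fun v => eval v t1 = eval v t2);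
  dc_let : forall t1 t2,
    C (fun v => sle (eval v t1) (eval v t2)) (fun v => sle (eval v t1) (eval v t2));
  dc_imp : forall P P' Q Q', C P P' -> C Q Q' ->
    C (fun v => P v -> Q v) (fun v => P' v -> Q' v);
  dc_and : forall P P' Q Q', C P P' -> C Q Q' ->
    C (fun v => P v /\ Q v) (fun v => P' v /\ Q' v);
  dc_or : forall P P' Q Q', C P P' -> C Q Q' ->
    C (fun v => P v \/ Q v) (fun v => P' v \/ Q' v);
  dc_sall : forall P P', C P P' ->
    C (fun v => forall a, P (scons a v)) (fun v => forall a, P' (scons a v));
  dc_sex : forall P P', C P P' ->
    C (fun v => exists a, P (scons a v)) (fun v => exists a, P' (scons a v));
  dc_ren : forall P P' r, C P P' ->
    C (fun v => P (fun i => v (r i))) (fun v => P' (fun i => v (r i))) }.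

Section DefClass.
Context (M N : structure) (C : biclass M N) (dc : defclass C).

(* Quantified bodies appear as functions of the bound element and the old
   valuation: this form is what second-order pattern unification solves. *)
Lemma dc_all (P : M -> (nat -> M) -> Prop) (P' : N -> (nat -> N) -> Prop) :
  C (fun v => P (v 0) (fun i => v i.+1)) (fun v => P' (v 0) (fun i => v i.+1)) ->
  C (fun v => forall a, P a v) (fun v => forall a, P' a v).
Proof. by move=> /(dc_sall dc). Qed.

Lemma dc_ex (P : M -> (nat -> M) -> Prop) (P' : N -> (nat -> N) -> Prop) :
  C (fun v => P (v 0) (fun i => v i.+1)) (fun v => P' (v 0) (fun i => v i.+1)) ->
  C (fun v => exists a, P a v) (fun v => exists a, P' a v).
Proof. by move=> /(dc_sex dc). Qed.

Lemma dc_not P P' : C P P' -> C (fun v => ~ P v) (fun v => ~ P' v).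
Proof. by move=> h; apply: (dc_imp dc h (dc_bot dc)). Qed.

Lemma dc_iff P P' Q Q' : C P P' -> C Q Q' ->
  C (fun v => P v <-> Q v) (fun v => P' v <-> Q' v).
Proof.
by move=> h k; apply: (dc_and dc); apply: (dc_imp dc).
Qed.

(** A function is definable when its graph is, so that functions denoted by no
    term are included. *)
Definition dterm (T : (nat -> M) -> M) (T' : (nat -> N) -> N) :=
  C (fun v => v 0 = T (fun i => v i.+1)) (fun v => v 0 = T' (fun i => v i.+1)).

Lemma dterm_eval t : dterm (fun v => eval v t) (fun v => eval v t).
Proof.
have /= := dc_eqt dc (Var 0) (ren_term S t).
by rewrite /dterm; under eq_fun do rewrite eval_ren; under [X in C _ X]eq_fun do rewrite eval_ren.
Qed.

Lemma dterm_var k : dterm (fun v => v k) (fun v => v k).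
Proof. exact: dterm_eval (Var k). Qed.

Lemma dc_subst (P : M -> (nat -> M) -> Prop) (P' : N -> (nat -> N) -> Prop) T T' :
  dterm T T' ->
  C (fun v => P (v 0) (fun i => v i.+1)) (fun v => P' (v 0) (fun i => v i.+1)) ->
  C (fun v => P (T v) v) (fun v => P' (T' v) v).
Proof.
move=> hT hP.
have -> : (fun v => P (T v) v) = (fun v => exists a, a = T v /\ P a v).
  by apply/funext => v; apply/propext; split; [exists (T v) | case=> _ [-> ]].
have -> : (fun v => P' (T' v) v) = (fun v => exists a, a = T' v /\ P' a v).
  by apply/funext => v; apply/propext; split; [exists (T' v) | case=> _ [-> ]].
by apply: dc_ex; apply: (dc_and dc).
Qed.

Lemma dc_eq T T' U U' : dterm T T' -> dterm U U' ->
  C (fun v => T v = U v) (fun v => T' v = U' v).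
Proof.
move=> hT hU.
apply: (dc_subst (P := fun a v => a = U v) (P' := fun a v => a = U' v) hT).
exact: hU.
Qed.

Lemma dterm_ren T T' r : dterm T T' ->
  dterm (fun v => T (fun i => v (r i))) (fun v => T' (fun i => v (r i))).
Proof. by move=> /(dc_ren dc (ren_up r)). Qed.

Lemma dc_le T T' U U' : dterm T T' -> dterm U U' ->
  C (fun v => sle (T v) (U v)) (fun v => sle (T' v) (U' v)).
Proof.
move=> hT hU.
apply: (dc_subst (P := fun a v => sle a (U v)) (P' := fun a v => sle a (U' v)) hT).
apply: (dc_subst (P := fun a v => sle (v 0) a) (P' := fun a v => sle (v 0) a)).
  exact: (dterm_ren S hU).
exact: (dc_let dc (Var 1) (Var 0)).
Qed.

Lemma dterm_comp (F : M -> (nat -> M) -> M) (F' : N -> (nat -> N) -> N) T T' :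
  dterm T T' ->
  dterm (fun v => F (v 0) (fun i => v i.+1)) (fun v => F' (v 0) (fun i => v i.+1)) ->
  dterm (fun v => F (T v) v) (fun v => F' (T' v) v).
Proof.
move=> hT hF.
apply: (dc_subst (P := fun a v => v 0 = F a (fun i => v i.+1))
   (P' := fun a v => v 0 = F' a (fun i => v i.+1))).
  exact: (dterm_ren S hT).
exact: (dc_ren dc (fun i => if i is 0 then 1 else if i is 1 then 0 else i) hF).
Qed.

Lemma dterm_add T T' U U' : dterm T T' -> dterm U U' ->
  dterm (fun v => sadd (T v) (U v)) (fun v => sadd (T' v) (U' v)).
Proof.
move=> hT hU.
apply: (dterm_comp (F := fun a v => sadd a (U v)) (F' := fun a v => sadd a (U' v)) hT).
apply: (dterm_comp (F := fun a v => sadd (v 0) a) (F' := fun a v => sadd (v 0) a)).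
  exact: (dterm_ren S hU).
exact: (dterm_eval (Add (Var 1) (Var 0))).
Qed.

Lemma dterm_mul T T' U U' : dterm T T' -> dterm U U' ->
  dterm (fun v => smul (T v) (U v)) (fun v => smul (T' v) (U' v)).
Proof.
move=> hT hU.
apply: (dterm_comp (F := fun a v => smul a (U v)) (F' := fun a v => smul a (U' v)) hT).
apply: (dterm_comp (F := fun a v => smul (v 0) a) (F' := fun a v => smul (v 0) a)).
  exact: (dterm_ren S hU).
exact: (dterm_eval (Mul (Var 1) (Var 0))).
Qed.

Lemma dterm_zero : dterm (fun _ => szero) (fun _ => szero).
Proof. exact: dterm_eval Zero. Qed.

Lemma dterm_one : dterm (fun _ => sone) (fun _ => sone).
Proof. exact: dterm_eval One. Qed.

Lemma dterm_tuple_eval (T : nat -> (nat -> M) -> M) (T' : nat -> (nat -> N) -> N) t :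
  (forall i, dterm (T i) (T' i)) ->
  dterm (fun v => eval (fun i => T i v) t) (fun v => eval (fun i => T' i v) t).
Proof.
move=> hT; elim: t => /=; [exact: hT | exact: dterm_zero | exact: dterm_one | |].
- by move=> t1 h1 t2 h2; exact: dterm_add.
- by move=> t1 h1 t2 h2; exact: dterm_mul.
Qed.

Lemma dc_mem (D : set M) (D' : set N) T T' :
  C (fun v => D (v 0)) (fun v => D' (v 0)) -> dterm T T' ->
  C (fun v => D (T v)) (fun v => D' (T' v)).
Proof.
move=> hD hT.
by apply: (dc_subst (P := fun a v => D a) (P' := fun a v => D' a) hT).
Qed.

(** Satisfaction is definable under substitution of infinitely many definable
    functions: an induction on the formula consults each of them only where
    its variable occurs. *)
Lemma dc_sat2 (S : Type) (V : S -> set M) (V' : S -> set N) (phi : formula S)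
    (T : nat -> (nat -> M) -> M) (T' : nat -> (nat -> N) -> N) :
  (forall s, C (fun v => V s (v 0)) (fun v => V' s (v 0))) ->
  (forall i, dterm (T i) (T' i)) ->
  C (fun v => sat2 V (fun i => T i v) phi) (fun v => sat2 V' (fun i => T' i v) phi).
Proof.
move=> hV; elim: phi T T' => /=.
- by move=> *; exact: (dc_bot dc).
- by move=> t1 t2 T T' hT; apply: dc_eq; exact: dterm_tuple_eval.
- by move=> t1 t2 T T' hT; apply: dc_le; exact: dterm_tuple_eval.
- by move=> X t T T' hT; apply: dc_mem => //; exact: dterm_tuple_eval.
- by move=> p hp q hq T T' hT; apply: (dc_imp dc); [exact: hp | exact: hq].
- by move=> p hp q hq T T' hT; apply: (dc_and dc); [exact: hp | exact: hq].
- by move=> p hp q hq T T' hT; apply: (dc_or dc); [exact: hp | exact: hq].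
- move=> p hp T T' hT; apply: dc_all.
  have -> : (fun v => sat2 V (scons (v 0) (fun i => T i (fun j => v j.+1))) p) =
     (fun v => sat2 V (fun i => (if i is j.+1 then fun u => T j (fun l => u l.+1)
                      else fun u => u 0) v) p).
    by apply/funext => v; congr (sat2 V _ p); apply/funext => -[].
  have -> : (fun v => sat2 V' (scons (v 0) (fun i => T' i (fun j => v j.+1))) p) =
     (fun v => sat2 V' (fun i => (if i is j.+1 then fun u => T' j (fun l => u l.+1)
                      else fun u => u 0) v) p).
    by apply/funext => v; congr (sat2 V' _ p); apply/funext => -[].
  apply: hp => -[|i]; [exact: dterm_var | exact: (dterm_ren succn (hT i))].
- move=> p hp T T' hT; apply: dc_ex.
  have -> : (fun v => sat2 V (scons (v 0) (fun i => T i (fun j => v j.+1))) p) =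
     (fun v => sat2 V (fun i => (if i is j.+1 then fun u => T j (fun l => u l.+1)
                      else fun u => u 0) v) p).
    by apply/funext => v; congr (sat2 V _ p); apply/funext => -[].
  have -> : (fun v => sat2 V' (scons (v 0) (fun i => T' i (fun j => v j.+1))) p) =
     (fun v => sat2 V' (fun i => (if i is j.+1 then fun u => T' j (fun l => u l.+1)
                      else fun u => u 0) v) p).
    by apply/funext => v; congr (sat2 V' _ p); apply/funext => -[].
  apply: hp => -[|i]; [exact: dterm_var | exact: (dterm_ren succn (hT i))].
Qed.

Lemma dc_sat (phi : fo_formula) T T' (F : nat -> (nat -> M) -> M)
    (F' : nat -> (nat -> N) -> N) :
  dterm T T' -> (forall i, dterm (F i) (F' i)) ->
  C (fun v => sat (scons (T v) (fun i => F i v)) phi)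
    (fun v => sat (scons (T' v) (fun i => F' i v)) phi).
Proof.
move=> hT hF.
have -> : (fun v => sat (scons (T v) (fun i => F i v)) phi) =
    (fun v => sat (fun i => (if i is j.+1 then F j else T) v) phi).
  by apply/funext => v; congr sat; apply/funext => -[].
have -> : (fun v => sat (scons (T' v) (fun i => F' i v)) phi) =
    (fun v => sat (fun i => (if i is j.+1 then F' j else T') v) phi).
  by apply/funext => v; congr sat; apply/funext => -[].
by apply: dc_sat2 => [[]|[|i]]; [exact: hT | exact: hF].
Qed.

End DefClass.

(** Variables in the even places and parameters in the odd ones: a predicate may
    then depend on any number of variables and a formula on any number of
    parameters. *)
Definition mix (T : Type) (v w : nat -> T) : nat -> T :=
  fun i => if odd i then w i./2 else v i./2.

Lemma mix_even T (v w : nat -> T) i : mix v w i.*2 = v i.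
Proof. by rewrite /mix odd_double doubleK. Qed.

Lemma mix_odd T (v w : nat -> T) i : mix v w i.*2.+1 = w i.
Proof. by rewrite /mix /= odd_double /= uphalf_double. Qed.

Lemma evenodd_ind (P : nat -> Prop) :
  (forall i, P i.*2) -> (forall i, P i.*2.+1) -> forall i, P i.
Proof.
by move=> he ho i; rewrite -(odd_double_half i); case: (odd i); [exact: ho | exact: he].
Qed.

Lemma mix_ext T (u u' : nat -> T) :
  (forall i, u i.*2 = u' i.*2) -> (forall i, u i.*2.+1 = u' i.*2.+1) -> u = u'.
Proof. by move=> he ho; apply/funext => i; elim/evenodd_ind: i. Qed.

Definition remix (re ro : nat -> nat) : nat -> nat :=
  fun i => if odd i then ro i./2 else re i./2.

Lemma remix_even re ro i : remix re ro i.*2 = re i.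
Proof. by rewrite /remix odd_double doubleK. Qed.

Lemma remix_odd re ro i : remix re ro i.*2.+1 = ro i.
Proof. by rewrite /remix /= odd_double /= uphalf_double. Qed.

Section Mix.
Context (T : Type).
Implicit Types (v w : nat -> T).

Lemma mix_ren v w r :
  mix (fun i => v (r i)) w =
  (fun i => mix v w (remix (fun j => (r j).*2) (fun j => j.*2.+1) i)).
Proof.
by apply: mix_ext => i; rewrite ?remix_even ?remix_odd ?mix_even ?mix_odd.
Qed.

Lemma mix_scons a v w :
  mix (scons a v) w =
  (fun i => scons a (mix v w)
     (remix (fun j => if j is l.+1 then l.*2.+1 else 0) (fun j => j.*2.+2) i)).
Proof.
apply: mix_ext => i; rewrite ?remix_even ?remix_odd ?mix_even ?mix_odd //=.
  by case: i => //= i; rewrite mix_even.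
by rewrite mix_odd.
Qed.

End Mix.

(** * Linked predicates *)

Lemma eval_double (M : structure) (v w : nat -> M) t :
  eval (mix v w) (ren_term (fun i => i.*2) t) = eval v t.
Proof. by rewrite eval_ren; congr eval; apply/funext => i; rewrite mix_even. Qed.

(** Definability by one formula with predicate symbols in [S], interpreted by
    [V] and [V'], and with parameters from a prescribed class [W] of pairs of
    valuations.  Closure under connectives asks only that two choices of
    parameters can be merged into one. *)
Definition defined_by (M N : structure) (S : Type) (V : S -> set M) (V' : S -> set N)
    (W : (nat -> M) -> (nat -> N) -> Prop) : biclass M N :=
  fun P P' => exists (phi : formula S) (w : nat -> M) (w' : nat -> N),
    [/\ W w w', forall v, P v = sat2 V (mix v w) phi &
        forall v, P' v = sat2 V' (mix v w') phi].

Definition mergeable (M N : structure) (S : Type) (V : S -> set M) (V' : S -> set N)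
    (W : (nat -> M) -> (nat -> N) -> Prop) :=
  forall w1 w1' w2 w2', W w1 w1' -> W w2 w2' -> exists w w' (t1 t2 : formula S -> formula S),
    W w w' /\ forall phi,
    [/\ forall v, sat2 V (mix v w) (t1 phi) = sat2 V (mix v w1) phi,
        forall v, sat2 V' (mix v w') (t1 phi) = sat2 V' (mix v w1') phi,
        forall v, sat2 V (mix v w) (t2 phi) = sat2 V (mix v w2) phi &
        forall v, sat2 V' (mix v w') (t2 phi) = sat2 V' (mix v w2') phi].

Lemma defined_by_class (M N : structure) (S : Type) (V : S -> set M) (V' : S -> set N)
    (W : (nat -> M) -> (nat -> N) -> Prop) :
  (exists w w', W w w') -> mergeable V V' W -> defclass (defined_by V V' W).
Proof.
move=> [w0 [w0' W0]] merge.
have bin P P' Q Q' (o : formula S -> formula S -> formula S) (op : Prop -> Prop -> Prop) :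
    (forall (K : structure) (U : S -> set K) v p q,
       sat2 U v (o p q) = op (sat2 U v p) (sat2 U v q)) ->
    defined_by V V' W P P' -> defined_by V V' W Q Q' ->
    defined_by V V' W (fun v => op (P v) (Q v)) (fun v => op (P' v) (Q' v)).
  move=> ho [phi [w1 [w1' [W1 h1 h1']]]] [psi [w2 [w2' [W2 h2 h2']]]].
  have [w [w' [t1 [t2 [Ww ht]]]]] := merge _ _ _ _ W1 W2.
  have [e1 e1' _ _] := ht phi; have [_ _ e2 e2'] := ht psi.
  exists (o (t1 phi) (t2 psi)), w, w'; split=> // v; rewrite ho.
    by rewrite e1 e2 h1 h2.
  by rewrite e1' e2' h1' h2'.
split.
- by exists Bot, w0, w0'.
- move=> t1 t2; exists (Eq (ren_term (fun i => i.*2) t1) (ren_term (fun i => i.*2) t2)).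
  by exists w0, w0'; split=> // v; rewrite /= !eval_double.
- move=> t1 t2; exists (Le (ren_term (fun i => i.*2) t1) (ren_term (fun i => i.*2) t2)).
  by exists w0, w0'; split=> // v; rewrite /= !eval_double.
- by move=> P P' Q Q'; apply: (bin _ _ _ _ (@Imp S) (fun a b => a -> b)).
- by move=> P P' Q Q'; apply: (bin _ _ _ _ (@And S) and).
- by move=> P P' Q Q'; apply: (bin _ _ _ _ (@Or S) or).
- move=> P P' [phi [w [w' [Ww h h']]]].
  set r := remix (fun j => if j is l.+1 then l.*2.+1 else 0) (fun j => j.*2.+2).
  exists (All (ren r phi)), w, w'; split=> // v /=; apply: eq_forall => a.
    by rewrite h mix_scons sat2_ren.
  by rewrite h' mix_scons sat2_ren.
- move=> P P' [phi [w [w' [Ww h h']]]].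
  set r := remix (fun j => if j is l.+1 then l.*2.+1 else 0) (fun j => j.*2.+2).
  exists (Ex (ren r phi)), w, w'; split=> // v /=; apply: eq_exists => a.
    by rewrite h mix_scons sat2_ren.
  by rewrite h' mix_scons sat2_ren.
- move=> P P' r [phi [w [w' [Ww h h']]]].
  exists (ren (remix (fun j => (r j).*2) (fun j => j.*2.+1)) phi), w, w'.
  by split=> // v; rewrite ?h ?h' mix_ren sat2_ren.
Qed.

(** When [f] is elementary, linked predicates have the same truth value at
    corresponding valuations: this is how statements pass between [M] and [N]. *)
Definition linked (M N : structure) (f : M -> N) : biclass M N :=
  fun P P' => exists (phi : fo_formula) (w : nat -> M),
    (forall v, P v = sat (mix v w) phi) /\
    (forall v, P' v = sat (mix v (fun i => f (w i))) phi).

Lemma linked_class (M N : structure) (f : M -> N) : defclass (linked f).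
Proof.
have -> : linked f = defined_by (fun s : void => match s with end)
    (fun s : void => match s with end) (fun w w' => w' = fun i => f (w i)).
  apply/funext => P; apply/funext => P'; apply/propext.
  split=> [[phi [w [h h']]]|[phi [w [_ [-> h h']]]]]; last by exists phi, w.
  by exists phi, w, (fun i => f (w i)).
apply: defined_by_class; first by exists (fun _ => szero), (fun _ => f szero).
move=> w1 _ w2 _ -> ->; exists (mix w1 w2), (mix (fun i => f (w1 i)) (fun i => f (w2 i))).
exists (ren (remix (fun j => j.*2) (fun j => j.*2.*2.+1))).
exists (ren (remix (fun j => j.*2) (fun j => j.*2.+1.*2.+1))).
split=> [|phi]; first by apply: mix_ext => i; rewrite ?mix_even ?mix_odd.
by split=> v; rewrite sat2_ren; congr sat2; apply: mix_ext => i;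
  rewrite ?remix_even ?remix_odd ?mix_even ?mix_odd ?mix_even ?mix_odd.
Qed.

Lemma linked_const (M N : structure) (f : M -> N) (m : M) :
  dterm (linked f) (fun _ => m) (fun _ => f m).
Proof. by exists (Eq (Var 0) (Var 1)), (fun _ => m). Qed.

Notation dfn M := (linked (@id M)).

Lemma dfn_const (M : structure) (m : M) : dterm (dfn M) (fun _ => m) (fun _ => m).
Proof. exact: linked_const. Qed.

Lemma linked_sat (M N : structure) (f : M -> N) (v : nat -> M) (phi : fo_formula) :
  linked f (fun u => sat (scons (u 0) v) phi)
           (fun u => sat (scons (u 0) (fun i => f (v i))) phi).
Proof.
apply: (dc_sat (linked_class f) phi (F := fun i _ => v i) (F' := fun i _ => f (v i))).
  exact: (dterm_var (linked_class f)).
by move=> i; exact: linked_const.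
Qed.

Lemma Def_dfn (M : structure) (D : set M) :
  Def M D <-> dfn M (fun v => D (v 0)) (fun v => D (v 0)).
Proof.
split=> [[phi [v ->]]|[phi [w [h _]]]]; first exact: linked_sat.
exists (ren (remix (fun _ => 0) S) phi), w; apply/funext => a /=.
rewrite (h (fun _ => a)) /sat sat2_ren; congr sat2.
by apply: mix_ext => i; rewrite ?remix_even ?remix_odd ?mix_even ?mix_odd.
Qed.

(** [D'] is the extension of the definable set [D] to [N], given as a relation
    because it is found by way of a definition of [D]. *)
Definition lset (M N : structure) (f : M -> N) (D : set M) (D' : set N) :=
  linked f (fun v => D (v 0)) (fun v => D' (v 0)).

Lemma Def_lset (M N : structure) (f : M -> N) (D : set M) :
  Def M D -> exists D' : set N, lset f D D'.
Proof.
move=> [phi [v ->]]; exists [set a | sat (scons a (fun i => f (v i))) phi].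
exact: linked_sat.
Qed.

Lemma linked_right (M N : structure) (f : M -> N) P P' :
  linked f P P' -> dfn N P' P'.
Proof. by move=> [phi [w [_ h]]]; exists phi, (fun i => f (w i)). Qed.

Lemma linked_left (M N : structure) (f : M -> N) P P' :
  linked f P P' -> dfn M P P.
Proof. by move=> [phi [w [h _]]]; exists phi, w. Qed.

Lemma lset_Def (M N : structure) (f : M -> N) (D : set M) (D' : set N) :
  lset f D D' -> Def N D'.
Proof. by move=> /linked_right /Def_dfn. Qed.

Lemma linked_transfer (M N : structure) (f : M -> N) P P' v :
  elementary f -> linked f P P' -> P v <-> P' (fun i => f (v i)).
Proof.
move=> ef [phi [w [h h']]]; rewrite h h' (ef phi (mix v w)).
suff -> : mix (fun i => f (v i)) (fun i => f (w i)) = (fun i => f (mix v w i)) by [].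
by apply/funext => i; rewrite /mix; case: odd.
Qed.

Lemma lset_transfer (M N : structure) (f : M -> N) D D' a :
  elementary f -> lset f D D' -> D a <-> D' (f a).
Proof. by move=> ef h; exact: (linked_transfer (fun _ => a) ef h). Qed.

(** Transfer of a universally quantified predicate: the finitely many variables
    that matter are quantified one after the other. *)
Lemma linked_forall (M N : structure) (f : M -> N) P P' :
  elementary f -> linked f P P' -> (forall v, P v) -> forall v, P' v.
Proof.
move=> ef hl hP.
have [phi [w [h h']]] := hl.
have [k hk] := sat2_bound phi.
have : forall v u : nat -> N, (forall i, i < k -> v i = u i) -> P' v -> P' u.
  move=> v u e; rewrite !h' /sat (hk _ _ _ (mix u (fun i => f (w i)))) //.
  move=> i ik; rewrite /mix; case: odd => //; apply: e.
  by apply: leq_ltn_trans ik; rewrite leq_half_double ltnW // ltnS -addnn leq_addr.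
clear phi w h h' hk.
elim: k P P' hl hP => [|k IH] P P' hl hP dep v.
  apply: (dep (fun i => f ((fun _ => szero) i)) v) => //.
  exact/(linked_transfer _ ef hl).
have key : forall u a, P' (scons a u).
  apply: (IH _ _ (dc_sall (linked_class f) hl) (fun u a => hP _)).
  by move=> u u' e h a; apply: dep (h a) => -[|i] //= ik; exact: e.
by apply: dep (key (fun i => v i.+1) (v 0)) => -[].
Qed.

(** * Notations, pairing, and the definability tactic *)

Declare Scope pa_scope.
Delimit Scope pa_scope with pa.
Notation "x + y" := (sadd x y) : pa_scope.
Notation "x * y" := (smul x y) : pa_scope.
Notation "x <= y" := (sle x y) : pa_scope.
(* The order is discrete. *)
Notation "x < y" := (sle (sadd x sone) y) : pa_scope.
Notation "0" := szero : pa_scope.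
Notation "1" := sone : pa_scope.

(** Injective because [x + y] is the integer part of the square root.  Being a
    polynomial, it preserves every cut closed under the operations. *)
Definition cpair (M : structure) (x y : M) : M := ((x + y) * (x + y) + x)%pa.

Lemma dterm_pair (M N : structure) (C : biclass M N) T T' U U' : defclass C ->
  dterm C T T' -> dterm C U U' ->
  dterm C (fun v => cpair (T v) (U v)) (fun v => cpair (T' v) (U' v)).
Proof.
move=> dc hT hU; rewrite /cpair.
apply: (dterm_add dc) => //.
by apply: (dterm_mul dc); apply: (dterm_add dc).
Qed.

(** Definability goals are solved by the shape of the predicate; the
    hypotheses supply the definability of set variables. *)
Ltac dstep C :=
  first
  [ assumption
  | lazymatch goal with
    | |- dterm _ _ _ =>
      first [ exact: (dterm_var C)
            | exact: (dterm_zero C) | exact: (dterm_one C)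
            | apply: (dterm_pair C)
            | apply: (dterm_add C) | apply: (dterm_mul C)
            | exact: linked_const | exact: dfn_const ]
    | |- _ (fun _ => False) _ => exact: (dc_bot C)
    | |- _ (fun v => ~ _) _ => apply: (dc_not C)
    | |- _ (fun v => _ /\ _) _ => apply: (dc_and C)
    | |- _ (fun v => _ \/ _) _ => apply: (dc_or C)
    | |- _ (fun v => _ <-> _) _ => apply: (dc_iff C)
    | |- _ (fun v => exists x, _) _ => apply: (dc_ex C)
    | |- _ (fun v => _ = _) _ => apply: (dc_eq C)
    | |- _ (fun v => sle _ _) _ => apply: (dc_le C)
    | |- _ (fun v => _ -> _) _ =>
       first [apply: (dc_imp C) | apply: (dc_all C)]
    | |- _ (fun v => forall x, _) _ => apply: (dc_all C)
    | |- _ (fun v => ?D _) _ =>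
       match goal with
       | H : Def _ D |- _ => apply: (dc_mem C (proj1 (Def_dfn D) H))
       | H : lset _ D _ |- _ => apply: (dc_mem C H)
       end
    end ].

Ltac dfn_tac :=
  first [apply/Def_dfn | rewrite /lset | idtac]; cbv beta delta [mkset];
  lazymatch goal with
  | |- linked ?f _ _ => repeat (progress dstep (linked_class f); cbv beta)
  | |- dterm (linked ?f) _ _ => repeat (progress dstep (linked_class f); cbv beta)
  end.


(** * Arithmetic in models of PA *)

Section Arithmetic.
Context (M : structure) (pa : PA M).
Local Open Scope pa_scope.
Implicit Types (x y z u v w : M) (D : set M).

Lemma PA_induct D : Def M D -> D 0 -> (forall x, D x -> D (x + 1)) -> forall x, D x.
Proof. by move=> [phi [v ->]] h0 hS x; exact: (PA_ind pa h0 hS). Qed.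


Lemma add0l x : 0 + x = x.
Proof.
move: x; apply: (PA_induct (D := [set x | 0 + x = x])); first by dfn_tac.
- exact: (PA_add0 pa).
- by move=> x /= h; rewrite (PA_addS pa) h.
Qed.

Lemma addSl x y : (x + 1) + y = (x + y) + 1.
Proof.
move: y; apply: (PA_induct (D := [set y | (x + 1) + y = (x + y) + 1])); first by dfn_tac.
- by rewrite /= !(PA_add0 pa).
- by move=> y /= h; rewrite !(PA_addS pa) h.
Qed.

Lemma addC x y : x + y = y + x.
Proof.
move: y; apply: (PA_induct (D := [set y | x + y = y + x])); first by dfn_tac.
- by rewrite /= (PA_add0 pa) add0l.
- by move=> y /= h; rewrite (PA_addS pa) h addSl.
Qed.

Lemma addA x y z : x + (y + z) = (x + y) + z.
Proof.
move: z; apply: (PA_induct (D := [set z | x + (y + z) = (x + y) + z])); first by dfn_tac.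
- by rewrite /= !(PA_add0 pa).
- by move=> z /= h; rewrite !(PA_addS pa) h.
Qed.

Lemma mul0l x : 0 * x = 0.
Proof.
move: x; apply: (PA_induct (D := [set x | 0 * x = 0])); first by dfn_tac.
- exact: (PA_mul0 pa).
- by move=> x /= h; rewrite (PA_mulS pa) h add0l.
Qed.

Lemma mulSl x y : (x + 1) * y = x * y + y.
Proof.
move: y; apply: (PA_induct (D := [set y | (x + 1) * y = x * y + y])); first by dfn_tac.
- by rewrite /= !(PA_mul0 pa) add0l.
- move=> y /= h; rewrite !(PA_mulS pa) h -!addA; congr (_ + _).
  by rewrite addA (addC y) -addA.
Qed.

Lemma mulC x y : x * y = y * x.
Proof.
move: y; apply: (PA_induct (D := [set y | x * y = y * x])); first by dfn_tac.
- by rewrite /= (PA_mul0 pa) mul0l.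
- by move=> y /= h; rewrite (PA_mulS pa) h mulSl.
Qed.

Lemma mulDl x y z : (x + y) * z = x * z + y * z.
Proof.
move: y; apply: (PA_induct (D := [set y | (x + y) * z = x * z + y * z])); first by dfn_tac.
- by rewrite /= mul0l !(PA_add0 pa).
- by move=> y /= h; rewrite addA !mulSl h addA.
Qed.

Lemma mulA x y z : x * (y * z) = (x * y) * z.
Proof.
move: x; apply: (PA_induct (D := [set x | x * (y * z) = (x * y) * z])); first by dfn_tac.
- by rewrite /= !mul0l.
- by move=> x /= h; rewrite !mulSl mulDl h.
Qed.

Lemma mul1l x : 1 * x = x.
Proof. by rewrite -(add0l 1) mulSl mul0l add0l. Qed.

Lemma PA_semiring : semi_ring_theory (0 : M) 1 sadd smul eq.
Proof.
split; [exact: add0l | exact: addC | exact: addA | exact: mul1l | exact: mul0l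
       | exact: mulC | exact: mulA | exact: mulDl].
Qed.

Add Ring PA_ring_arith : PA_semiring.

Lemma addIr z x y : x + z = y + z -> x = y.
Proof.
move: z; apply: (PA_induct (D := [set z | x + z = y + z -> x = y])); first by dfn_tac.
- by rewrite /= !(PA_add0 pa).
- by move=> z /= h; rewrite !(PA_addS pa) => /(PA_succ_inj pa).
Qed.

Lemma zero_or_succ x : x = 0 \/ exists y, x = y + 1.
Proof.
move: x; apply: (PA_induct (D := [set x | x = 0 \/ exists y, x = y + 1])); first by dfn_tac.
- by left.
- by move=> x _; right; exists x.
Qed.

Lemma add_eq0 x y : x + y = 0 -> y = 0.
Proof.
case: (zero_or_succ y) => [->//|[z ->]].
by rewrite (PA_addS pa) => /(PA_succ_neq0 pa).
Qed.

Lemma le_ex x y : x <= y -> exists z, y = x + z.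
Proof. by move=> /(PA_le pa) [z <-]; exists z; ring. Qed.

Lemma le_addr x y : x <= x + y.
Proof. by apply/(PA_le pa); exists y; ring. Qed.

Lemma le_addl x y : x <= y + x.
Proof. by apply/(PA_le pa); exists y; ring. Qed.

Lemma le0 x : 0 <= x.
Proof. by rewrite -(add0l x); exact: le_addr. Qed.

Lemma lerefl x : x <= x.
Proof. by rewrite -{2}(add0l x); exact: le_addl. Qed.

Lemma letr y x z : x <= y -> y <= z -> x <= z.
Proof.
move=> /le_ex [u ->] /le_ex [v ->]; rewrite -addA; exact: le_addr.
Qed.

Lemma leanti x y : x <= y -> y <= x -> x = y.
Proof.
move=> /le_ex [u ->] /le_ex [v]; rewrite -{1}(PA_add0 pa x) -addA (addC x 0).
by rewrite (addC x) => /addIr /esym /[dup] /add_eq0 -> ; rewrite (PA_add0 pa) => ->; ring.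
Qed.

Lemma letotal x y : x <= y \/ y < x.
Proof.
move: x; apply: (PA_induct (D := [set x | x <= y \/ y < x])); first by dfn_tac.
- by left; exact: le0.
- move=> x /= [/le_ex [z ->]|h]; last by right; exact: letr h (le_addr _ _).
  case: (zero_or_succ z) => [->|[w ->]].
    by right; rewrite (PA_add0 pa); exact: lerefl.
  by left; apply/(PA_le pa); exists w; ring.
Qed.

Lemma ltirr x : ~ x < x.
Proof.
move=> /le_ex [z]; rewrite -{1}(add0l x) (_ : x + 1 + z = z + 1 + x); last by ring.
by move=> /addIr /esym /(PA_succ_neq0 pa).
Qed.

Lemma ltlt0 x : ~ x < 0.
Proof.
by move=> /le_ex [z]; rewrite -addA (addC 1) addA => /esym /(PA_succ_neq0 pa).
Qed.

Lemma ltW x y : x < y -> x <= y.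
Proof. by apply: letr; exact: le_addr. Qed.

Lemma lenlt x y : x <= y <-> ~ y < x.
Proof.
split=> [xy yx|h]; first by apply: (ltirr (x := x)); apply: letr _ yx; case/le_ex: xy => z ->; apply/(PA_le pa); exists z; ring.
by case: (letotal x y).
Qed.

Lemma ltnle x y : x < y <-> ~ y <= x.
Proof.
split=> [xy yx|h]; first by have /lenlt := yx.
by case: (letotal y x).
Qed.

Lemma leltadd x y : x <= y <-> x < y + 1.
Proof.
split=> [/le_ex [z ->]|/le_ex [z]].
  by apply/(PA_le pa); exists z; ring.
rewrite (_ : x + 1 + z = (x + z) + 1); last by ring.
by move=> /addIr ->; exact: le_addr.
Qed.

Lemma ltSle x y : x < y + 1 -> x <= y.
Proof. by case: (leltadd x y). Qed.

Lemma lt_succ x : x < x + 1.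
Proof. exact: lerefl. Qed.

Lemma le_eqVlt x y : x <= y <-> x = y \/ x < y.
Proof.
split=> [/le_ex [z ->]|[->|/ltW//]]; last exact: lerefl.
case: (zero_or_succ z) => [->|[w ->]]; first by left; rewrite (PA_add0 pa).
by right; apply/(PA_le pa); exists w; ring.
Qed.

Lemma ltletr y x z : x < y -> y <= z -> x < z.
Proof. exact: letr. Qed.

Lemma le_add2 x y u v : x <= y -> u <= v -> x + u <= y + v.
Proof. by move=> /le_ex [z ->] /le_ex [w ->]; apply/(PA_le pa); exists (z + w); ring. Qed.

Lemma leltr y x z : x <= y -> y < z -> x < z.
Proof. by move=> h; apply: letr; apply: le_add2 => //; exact: lerefl. Qed.

Lemma lt_neq x y : x < y -> x <> y.
Proof. by move=> h e; rewrite e in h; exact: ltirr h. Qed.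

Lemma lt_slt x y : slt x y <-> x < y.
Proof.
split=> [[/le_eqVlt [//|//]]|h]; last by split; [exact: ltW | exact: lt_neq].
Qed.

Lemma le_mul2 x y u v : x <= y -> u <= v -> x * u <= y * v.
Proof.
by move=> /le_ex [z ->] /le_ex [w ->]; apply/(PA_le pa); exists (x * w + z * u + z * w); ring.
Qed.

Lemma least D : Def M D -> D !=set0 -> exists2 x, D x & forall y, D y -> x <= y.
Proof.
move=> dD [d Dd]; apply: contrapT => none.
have : forall x y, y <= x -> ~ D y.
  apply: (PA_induct (D := [set x | forall y, y <= x -> ~ D y])); first by dfn_tac.
    move=> y /= y0 Dy; apply: none; exists y => // z _.
    by apply: letr y0 (le0 _).
  move=> x /= h y /le_eqVlt [->|/ltSle]; last exact: h.
  move=> Dx; apply: none; exists (x + 1) => // z Dz.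
  by by case: (letotal (x + 1) z) => // /ltSle /h.
by move=> /(_ d d (lerefl d)).
Qed.

Lemma le_max x y : exists z, [/\ x <= z, y <= z & z = x \/ z = y].
Proof.
case: (letotal x y) => [h|/ltW h].
  by exists y; split=> //; [exact: lerefl | right].
by exists x; split=> //; [exact: lerefl | left].
Qed.

Lemma cpair_inj x y x' y' : cpair x y = cpair x' y' -> x = x' /\ y = y'.
Proof.
have lt_sum (a b a' b' : M) : cpair a b = cpair a' b' -> ~ (a + b < a' + b').
  move=> e /[dup] h /(le_mul2 h) k.
  apply: (ltirr (x := cpair a' b')); rewrite -{1}e.
  apply: letr _ (letr k (le_addr _ _)); rewrite /cpair.
  by apply/(PA_le pa); exists (a + b + b); ring.
move=> e; have s : x + y = x' + y'.
  by apply: leanti; apply/lenlt; [exact: lt_sum (esym e) | exact: lt_sum e].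
move: e; rewrite /cpair s (addC _ x) (addC _ x') => /addIr ex; split=> //.
by move: s; rewrite ex !(addC x') => /addIr.
Qed.

Lemma le_sqr x : x <= x * x.
Proof.
case: (zero_or_succ x) => [->|[y ->]]; first exact: le0.
by apply/(PA_le pa); exists (y * y + y); ring.
Qed.

Lemma le_cpairl x y : x <= cpair x y.
Proof. exact: le_addl. Qed.

Lemma le_cpairr x y : y <= cpair x y.
Proof.
apply: letr (le_addl y x) _; apply: letr (le_sqr _) _; exact: le_addr.
Qed.

Lemma cpair_mono x y x' y' : x <= x' -> y <= y' -> cpair x y <= cpair x' y'.
Proof.
move=> hx hy; apply: le_add2 => //; apply: le_mul2; exact: le_add2.
Qed.

End Arithmetic.


(** * Coding definable sets below a bound *)

Section Coding.
Context (M : structure) (pa : PA M).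
Local Open Scope pa_scope.
Implicit Types (x y z v m s : M) (D : set M).

Add Ring PA_ring_coding : (PA_semiring pa).

(** Membership in the set coded by [m] and [s].  When every number up to the
    bound divides [m], the moduli [1 + (j + 1) * m] are pairwise coprime, and a
    product of some of them remembers its factors. *)
Definition codes (M : structure) (m s : M) : set M :=
  [set j | exists q, s = (1 + (j + 1) * m) * q].

Let dvd (d x : M) := exists q, x = d * q.

Lemma dvd_cancel d x y : dvd d (x + y) -> dvd d x -> dvd d y.
Proof.
move=> [q hq] [p hp]; case: (letotal pa p q) => /(le_ex pa) [r hr].
  exists r; apply: (addIr pa (z := x)); rewrite (addC pa y) hq hr hp; ring.
have : 0 + x = (d + d * r + y) + x.
  rewrite (_ : d + d * r + y + x = d + d * r + (x + y)); last by ring.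
  by rewrite hq hp hr; ring.
move=> /(addIr pa) /esym /(add_eq0 pa) ->.
by exists 0; ring.
Qed.

Lemma dvd_cofactor d x y : dvd d x -> dvd d (x * y).
Proof. by move=> [q ->]; exists (q * y); ring. Qed.

Lemma common_multiple v : exists m, m <> 0 /\ forall i, i < v -> exists q, m = (i + 1) * q.
Proof.
move: v; apply: (PA_induct pa (D := [set v | exists m, m <> 0 /\
   forall i, i < v -> exists q, m = (i + 1) * q])); first by dfn_tac.
  exists 1; split=> [h|i /(ltlt0 pa) //].
  by apply: (PA_succ_neq0 pa (x := 0)); rewrite (add0l pa).
move=> v [m [m0 hm]]; exists (m * (v + 1)); split=> [|i /(ltSle pa) /(le_eqVlt pa)].
  case: (zero_or_succ pa m) => [//|[n ->]] e; apply: (PA_succ_neq0 pa (x := n * v + n + v)).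
  by rewrite -e; ring.
case=> [->|/hm [q ->]]; first by exists m; ring.
by exists (q * (v + 1)); ring.
Qed.

(** If [d_i] is the modulus [1 + (i + 1) * m], then
    [(k + 1) d_j - (j + 1) d_k = k - j] divides [m], which is prime to [d_j]. *)
Lemma moduli_coprime v m s j k :
  (forall i, i < v -> exists q, m = (i + 1) * q) -> j < v -> k < v -> j <> k ->
  codes m (s * (1 + (k + 1) * m)) j -> codes m s j.
Proof.
move=> hm jv kv jk; rewrite /codes /= -!/(dvd _ _) => dsk.
set dj := 1 + (j + 1) * m.
have fin r : r < v -> dvd dj (s * (r + 1)) -> dvd dj s.
  move=> /hm [q hq] h; apply: (@dvd_cancel _ (s * (j + 1) * m)).
    by exists s; rewrite /dj; ring.
  rewrite hq (_ : s * (j + 1) * ((r + 1) * q) = s * (r + 1) * ((j + 1) * q)); last by ring.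
  exact: dvd_cofactor.
case: (letotal pa j k) => [/(le_eqVlt pa) [//|]|] /(le_ex pa) [r hr].
- apply: (fin r).
    by apply: (letr pa _ kv); rewrite hr; apply/(PA_le pa); exists (j + 1); ring.
  apply: (@dvd_cancel _ (s * (1 + (k + 1) * m) * (j + 1))); last exact: dvd_cofactor.
  by exists (s * (k + 1)); rewrite /dj hr; ring.
- apply: (fin r).
    by apply: (letr pa _ jv); rewrite hr; apply/(PA_le pa); exists (k + 1); ring.
  apply: (@dvd_cancel _ (dj * (s * (k + 1)))); last by exists (s * (k + 1)).
  rewrite (_ : dj * (s * (k + 1)) + s * (r + 1) = s * (1 + (k + 1) * m) * (j + 1)).
    exact: dvd_cofactor.
  by rewrite /dj hr; ring.
Qed.

Lemma coding D v : Def M D -> exists m s, forall j, j < v -> (codes m s j <-> D j).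
Proof.
move=> dD; have [m [m0 hm]] := common_multiple v.
(* The code is the product of the moduli of the members of [D] below [k]. *)
suff : forall k, k <= v -> exists s, forall j, j < v -> (codes m s j <-> j < k /\ D j).
  move=> /(_ v (lerefl pa v)) [s hs]; exists m, s => j jv; rewrite hs //.
  by split=> [[]|].
apply: (PA_induct pa (D := [set k | k <= v -> exists s, forall j, j < v ->
   (codes m s j <-> j < k /\ D j)])); first by rewrite /codes; dfn_tac.
  move=> _; exists 1 => j jv; split=> [[q hq]|[/(ltlt0 pa) //]]; exfalso.
  case: (zero_or_succ pa m) => [//|[n hn]].
  case: (zero_or_succ pa q) => [q0|[p hp]].
    by apply: (PA_succ_neq0 pa (x := 0)); rewrite (add0l pa) hq q0; ring.
  apply: (PA_succ_neq0 pa (x := j * n + n + j + p * (1 + (j + 1) * (n + 1)))).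
  apply: (addIr pa (z := 1)); rewrite (add0l pa) [RHS]hq hn hp; ring.
move=> k IH /[dup] kv /(ltW pa) /IH [s hs]; have [Dk|nDk] := pselect (D k).
  exists (s * (1 + (k + 1) * m)) => j jv; have [->|jk] := pselect (j = k).
    split=> _; last by exists s; ring.
    by split=> //; exact: (lt_succ pa).
  transitivity (codes m s j).
    split; first exact: (moduli_coprime hm).
    by move=> h; exact: dvd_cofactor.
  rewrite hs //; split=> -[jk1 Dj]; split=> //; first by apply: (ltletr pa jk1); exact: le_addr.
  by case/(le_eqVlt pa): (ltSle pa jk1).
exists s => j jv; rewrite hs //; split=> -[jk Dj]; split=> //.
  by apply: (ltletr pa jk); exact: le_addr.
by case/(le_eqVlt pa): (ltSle pa jk) => // e; rewrite e in Dj.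
Qed.

(** Definable course-of-values recursion: as row [x] is determined by the rows
    below it, a code that is correct up to [x] can be replaced by one that is
    correct one row further. *)
Lemma recursion (T : set M -> M -> M -> Prop) v :
  dfn M (fun w => T (codes (w 0%N) (w 1%N)) (w 2) (w 3))
        (fun w => T (codes (w 0%N) (w 1%N)) (w 2) (w 3)) ->
  (forall c c' x y, (forall x' y', x' < x -> y' <= x' ->
      (c (cpair x' y') <-> c' (cpair x' y'))) -> T c x y -> T c' x y) ->
  exists m s, forall x y, x < v -> y <= x -> (codes m s (cpair x y) <-> T (codes m s) x y).
Proof.
move=> dT loc.
have dTT : forall (a b c d : (nat -> M) -> M),
    dterm (dfn M) a a -> dterm (dfn M) b b -> dterm (dfn M) c c -> dterm (dfn M) d d ->
    dfn M (fun w => T (codes (a w) (b w)) (c w) (d w))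
        (fun w => T (codes (a w) (b w)) (c w) (d w)).
  move=> a b c d ha hb hc hd; pose C := linked_class (@id M).
  apply: (dc_subst C (P := fun x w => T (codes x (b w)) (c w) (d w))
    (P' := fun x w => T (codes x (b w)) (c w) (d w)) ha).
  apply: (dc_subst C (P := fun y w => T (codes (w 0%N) y) (c (fun i => w i.+1)) (d (fun i => w i.+1)))
    (P' := fun y w => T (codes (w 0%N) y) (c (fun i => w i.+1)) (d (fun i => w i.+1)))
     (dterm_ren C succn hb)).
  apply: (dc_subst C (P := fun y w => T (codes (w 1%N) (w 0%N)) y (d (fun i => w i.+2)))
    (P' := fun y w => T (codes (w 1%N) (w 0%N)) y (d (fun i => w i.+2)))
     (dterm_ren C (fun i => i.+2) hc)).
  apply: (dc_subst C (P := fun y w => T (codes (w 2) (w 1%N)) (w 0%N) y)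
    (P' := fun y w => T (codes (w 2) (w 1%N)) (w 0%N) y)
     (dterm_ren C (fun i => i.+3) hd)).
  exact: (dc_ren C (fun i => match i with 0%N => 3 | 1%N => 2 | 2 => 1%N | 3 => 0%N | _ => i end) dT).
move: v; apply: (PA_induct pa (D := [set v | exists m s, forall x y, x < v -> y <= x ->
   (codes m s (cpair x y) <-> T (codes m s) x y)])).
  dfn_tac; last by apply: dTT; dfn_tac.
  by rewrite /codes; dfn_tac.
  by exists 0, 0 => x y /(ltlt0 pa).
move=> v [m [s hms]].
have dD : Def M [set z | exists x y, z = cpair x y /\ y <= x /\ x <= v /\ T (codes m s) x y].
  by dfn_tac; apply: dTT; dfn_tac.
have [m' [s' hms']] := coding (cpair v v + 1) dD.
have row x y : x <= v -> y <= x -> (codes m' s' (cpair x y) <-> T (codes m s) x y).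
  move=> xv yx; rewrite hms'; last first.
    apply: (leltr pa _ (lt_succ pa _)); apply: (cpair_mono pa) => //; exact: (letr pa yx xv).
  split=> [[x1 [y1 []]]|h]; last by exists x, y.
  by move=> /(cpair_inj pa) [<- <-] [_ []].
exists m', s' => x y /(ltSle pa) xv yx; rewrite row //.
have agree x' y' : x' < x -> y' <= x' ->
    (codes m s (cpair x' y') <-> codes m' s' (cpair x' y')).
  move=> x'x y'x'; rewrite row //; last exact: (letr pa (ltW pa x'x) xv).
  by rewrite hms //; exact: (letr pa x'x xv).
split; apply: loc => // x' y' h1 h2; by rewrite agree.
Qed.

(** A definable set that stopped at the cut would be closed under successor and
    so, by induction, be everything. *)
Lemma overspill D J : Def M D -> cut J -> (forall x, J x -> D x) ->
  exists2 c, ~ J c & forall y, y <= c -> D y.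
Proof.
move=> dD [[b Jb] JT dn] JD; apply: contrapT => none; apply: JT.
apply/seteqP; split=> // + _.
have J0 : J 0 by apply: dn Jb _; exact: (le0 pa).
have key x : (forall y, y <= x -> D y) -> J x.
  by move=> h; apply: contrapT => nJ; apply: none; exists x.
suff h : forall x y, y <= x -> D y by move=> x; exact: key (h x).
apply: (PA_induct pa (D := [set x | forall y, y <= x -> D y])); first by dfn_tac.
  by move=> y /= y0; apply/JD/(dn _ _ J0); exact: (letr pa y0 (le_addr pa _ _)).
by move=> x /= /key Jx y yx; apply/JD/(dn _ _ Jx).
Qed.

End Coding.


(** * Elementary extensions *)

Section Elementary.
Context (M N : structure) (f : M -> N) (ef : elementary f).
Local Open Scope pa_scope.

Lemma elementary0 : f 0 = 0.
Proof. by have /(_ (fun _ => 0)) [/(_ erefl)] := ef (Eq (Var 0) Zero). Qed.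

Lemma elementary1 : f 1 = 1.
Proof. by have /(_ (fun _ => 1)) [/(_ erefl)] := ef (Eq (Var 0) One). Qed.

Lemma elementaryD x y : f (x + y) = f x + f y.
Proof.
have /(_ (scons (x + y) (scons x (fun _ => y)))) := ef (Eq (Var 0) (Add (Var 1) (Var 2))).
by case=> /(_ erefl).
Qed.

Lemma elementaryM x y : f (x * y) = f x * f y.
Proof.
have /(_ (scons (x * y) (scons x (fun _ => y)))) := ef (Eq (Var 0) (Mul (Var 1) (Var 2))).
by case=> /(_ erefl).
Qed.

Lemma elementary_pair x y : f (cpair x y) = cpair (f x) (f y).
Proof. by rewrite /cpair elementaryD elementaryM !elementaryD. Qed.

Lemma elementary_le x y : x <= y <-> f x <= f y.
Proof. exact: ef (Le (Var 0) (Var 1)) (scons x (fun _ => y)). Qed.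

Lemma elementary_lt x y : x < y <-> f x < f y.
Proof. by rewrite elementary_le elementaryD elementary1. Qed.

Lemma elementary_inj x y : f x = f y -> x = y.
Proof. by have [] := ef (Eq (Var 0) (Var 1)) (scons x (fun _ => y)). Qed.

(** An instance of induction speaks of all values of its parameters, so it
    passes to [N] as a universally quantified linked predicate. *)
Lemma PA_elementary : PA M -> PA N.
Proof.
move=> pa; pose C := linked_class f.
split.
- move=> x; have := linked_forall ef (P := fun v => ~ (v 0%N + 1 = 0))
   (P' := fun v => ~ (v 0%N + 1 = 0)) _ _ (fun _ => x); apply; first by dfn_tac.
  by move=> v; exact: (PA_succ_neq0 pa).
- move=> x y; have := linked_forall ef (P := fun v => v 0%N + 1 = v 1%N + 1 -> v 0%N = v 1%N)
   (P' := fun v => v 0%N + 1 = v 1%N + 1 -> v 0%N = v 1%N) _ _ (scons x (fun _ => y)); apply; first by dfn_tac.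
  by move=> v; exact: (PA_succ_inj pa).
- move=> x; have := linked_forall ef (P := fun v => v 0%N + 0 = v 0%N)
   (P' := fun v => v 0%N + 0 = v 0%N) _ _ (fun _ => x); apply; first by dfn_tac.
  by move=> v; exact: (PA_add0 pa).
- move=> x y; have := linked_forall ef (P := fun v => v 0%N + (v 1%N + 1) = v 0%N + v 1%N + 1)
   (P' := fun v => v 0%N + (v 1%N + 1) = v 0%N + v 1%N + 1) _ _ (scons x (fun _ => y)); apply; first by dfn_tac.
  by move=> v; exact: (PA_addS pa).
- move=> x; have := linked_forall ef (P := fun v => v 0%N * 0 = 0)
   (P' := fun v => v 0%N * 0 = 0) _ _ (fun _ => x); apply; first by dfn_tac.
  by move=> v; exact: (PA_mul0 pa).
- move=> x y; have := linked_forall ef (P := fun v => v 0%N * (v 1%N + 1) = v 0%N * v 1%N + v 0%N)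
   (P' := fun v => v 0%N * (v 1%N + 1) = v 0%N * v 1%N + v 0%N) _ _ (scons x (fun _ => y)); apply; first by dfn_tac.
  by move=> v; exact: (PA_mulS pa).
- move=> x y; have := linked_forall ef (P := fun v => v 0%N <= v 1%N <-> exists z, z + v 0%N = v 1%N)
   (P' := fun v => v 0%N <= v 1%N <-> exists z, z + v 0%N = v 1%N) _ _ (scons x (fun _ => y)); apply; first by dfn_tac.
  by move=> v; exact: (PA_le pa).
- move=> phi.
  have sub (T : (nat -> M) -> M) (T' : (nat -> N) -> N) k : dterm (linked f) T T' ->
    linked f (fun v => sat (scons (T v) (fun i => v (i + k)%N)) phi)
             (fun v => sat (scons (T' v) (fun i => v (i + k)%N)) phi).
    move=> hT; apply: (dc_sat C phi (F := fun i v => v (i + k)%N)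
      (F' := fun i v => v (i + k)%N)) => // i; exact: (dterm_var C).
  have := linked_forall ef (P := fun v => sat (scons 0 v) phi ->
    (forall x, sat (scons x v) phi -> sat (scons (x + 1) v) phi) -> forall x, sat (scons x v) phi)
    (P' := fun v => sat (scons 0 v) phi ->
    (forall x, sat (scons x v) phi -> sat (scons (x + 1) v) phi) -> forall x, sat (scons x v) phi).
  apply; last by move=> v; exact: (PA_ind pa).
  have sub0 := sub (fun v => 0) (fun v => 0) 0%N (dterm_zero C).
  have sub1 := sub _ _ 1%N (dterm_var C 0%N).
  have sub2 := sub _ _ 1%N (dterm_add C (dterm_var C 0%N) (dterm_one C)).
  have z (T : structure) (v : nat -> T) : (fun i => v (i + 0)%N) = v.
    by apply/funext => i; rewrite addn0.
  have o (T : structure) (v : nat -> T) : (fun i => v (i + 1)%N) = fun i => v i.+1.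
    by apply/funext => i; rewrite addn1.
  apply: (dc_imp C); first by move: sub0; under eq_fun do rewrite z; under [X in _ X -> _]eq_fun do rewrite z.
  have {}sub1 : linked f (fun v => sat (scons (v 0%N) (fun i => v i.+1)) phi)
             (fun v => sat (scons (v 0%N) (fun i => v i.+1)) phi).
    by move: sub1; under eq_fun do rewrite o; under [X in _ X -> _]eq_fun do rewrite o.
  have {}sub2 : linked f (fun v => sat (scons (v 0%N + 1) (fun i => v i.+1)) phi)
             (fun v => sat (scons (v 0%N + 1) (fun i => v i.+1)) phi).
    by move: sub2; under eq_fun do rewrite o; under [X in _ X -> _]eq_fun do rewrite o.
  by apply: (dc_imp C); apply: (dc_all C) => //; apply: (dc_imp C).
Qed.

End Elementary.


(** * Cuts and coded sets *)

Section Cuts.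
Context (M : structure) (pa : PA M) (I : set M) (Icut : cut I).
Local Open Scope pa_scope.

Lemma cut_le a b : I b -> a <= b -> I a.
Proof.
case: Icut => _ _ dn Ib ab; apply: dn Ib _; exact: (letr pa ab (le_addr pa _ _)).
Qed.

Lemma cut_succ b : I b -> I (b + 1).
Proof. by case: Icut => _ _ dn Ib; apply: dn Ib _; exact: (lerefl pa). Qed.

Lemma cut_out : exists c, ~ I c.
Proof.
case: Icut => _ IT _; apply: contrapT => h; apply: IT; apply/seteqP; split=> // x _.
by apply: contrapT => nI; apply: h; exists x.
Qed.

Lemma cut_lt a c : I a -> ~ I c -> a < c.
Proof. by move=> Ia nc; apply/(ltnle pa) => /(cut_le Ia). Qed.

Lemma cut_cpair (Iadd : closed_under sadd I) (Imul : closed_under smul I) a b :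
  I a -> I b -> I (cpair a b).
Proof. by move=> Ia Ib; apply: (Iadd) => //; apply: Imul; apply: Iadd. Qed.

End Cuts.

Section GCIS.
Context (M N : structure) (f : M -> N) (pa : PA M) (ef : elementary f).
Context (I : set M) (Icut : cut I) (IG : GCIS f = I).
Local Open Scope pa_scope.

Let paN : PA N := PA_elementary ef pa.

Lemma GCIS_below a y : I a -> y <= f a -> exists x, [/\ I x, x <= a & y = f x].
Proof.
rewrite -{1}IG => h ya; have : initial_segment (f a) y by split=> //; exact: (le0 paN).
rewrite -(h : f @` _ = _) => -[x [_ xa] <-]; exists x; split=> //.
apply: (cut_le pa Icut) xa; by rewrite -IG.
Qed.

Lemma image_mem a : (f @` I) (f a) <-> I a.
Proof.
by split=> [[x Ix /(elementary_inj ef) <-]|Ia]; last exists a.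
Qed.

Lemma cut_image : cut (f @` I).
Proof.
split.
- by exists (f 0), 0 => //; exact: cut_zero.
- case: (cut_out Icut) => c nc e; apply: nc; apply/image_mem; by rewrite e.
- move=> a _ [b Ib <-]; rewrite -(elementary1 ef) -(elementaryD ef).
  by move=> /(GCIS_below (cut_succ pa Icut Ib)) [x [Ix _ ->]]; exists x.
Qed.

End GCIS.

Section Coded.
Context (M N : structure) (f : M -> N) (pa : PA M) (ef : elementary f).
Context (I : set M) (XX : set (set M)).
Context (codf : Cod_ext_eq f I XX).
Local Open Scope pa_scope.

Lemma coded_trace X : XX X -> exists2 D, Def N D & forall a, I a -> (X a <-> D (f a)).
Proof.
move=> hX; have : [set f @` Y | Y in XX] (f @` X) by exists X.
rewrite -codf => -[D dD e]; exists D => // a Ia.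
have im : (f @` X) (f a) <-> X a.
  by split=> [[x Xx /(elementary_inj ef) <-]|Xa]; last exists a.
by rewrite -im -e; split=> [[]|Da] //; split=> //; exists a.
Qed.

Lemma trace_coded D : Def N D -> XX [set a | I a /\ D (f a)].
Proof.
move=> dD; have : Cod (f @` I) (f @` I `&` D) by exists D.
rewrite codf => -[X hX e]; rewrite (_ : [set a | _] = X) //.
apply/seteqP; split=> a /=.
  move=> [Ia Da]; have : (f @` X) (f a) by rewrite e; split=> //; exists a.
  by move=> [x Xx /(elementary_inj ef) <-].
move=> Xa; have : (f @` X) (f a) by exists a.
by rewrite e => -[[x Ix /(elementary_inj ef) <-]].
Qed.

End Coded.

Section CodedInduction.
Context (M N : structure) (f : M -> N) (pa : PA M) (ef : elementary f).
Context (I : set M) (Icut : cut I) (IG : GCIS f = I).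
Local Open Scope pa_scope.

(** The elements of [N] up to [f a] all come from [I], so that induction in [N] on
    the statement restricted to them stays inside [I]. *)
Lemma trace_induction (D : set N) : Def N D -> D (f 0) ->
  (forall x, I x -> D (f x) -> D (f (x + 1))) -> forall a, I a -> D (f a).
Proof.
have paN := PA_elementary ef pa.
move=> dD D0 DS a Ia.
suff : forall y, y <= f a -> D y by apply; exact: (lerefl paN).
apply: (PA_induct paN (D := [set y | y <= f a -> D y])); first by dfn_tac.
  by move=> _; rewrite -(elementary0 ef).
move=> y /= h hy; have ya : y <= f a by exact: (ltW paN hy).
have [x [Ix xa e]] := GCIS_below pa ef Icut IG Ia ya.
rewrite e -(elementary1 ef) -(elementaryD ef); apply: DS => //.
by rewrite -e; exact: h.
Qed.

End CodedInduction.

Section Fills.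
Context (M N N0 : structure) (f : M -> N) (f0 : M -> N0) (pa : PA M).
Context (ef : elementary f) (ef0 : elementary f0).
Context (I : set M) (XX : set (set M)) (Icut : cut I).
Context (codf0 : Cod_ext_eq f0 I XX) (IG0 : GCIS f0 = I) (codf : Cod_ext_eq f I XX).
Local Open Scope pa_scope.

(** A new element below [f a], with [a] in [I], would determine a bounded
    initial segment of [I] without a maximum, which [N0] could not code. *)
Lemma fills_GCIS b : fills f I b -> GCIS f = I.
Proof.
move=> fb; have paN := PA_elementary ef pa.
apply/seteqP; split=> [b0 hb0|b0 Ib0].
  apply: contrapT => nI; have [_ [/[dup] bb0 + _]] := fb 0 b0 (cut_zero pa Icut) nI.
  have : initial_segment (f b0) b by split; [exact: (le0 paN) | exact: bb0].
  rewrite -(hb0 : f @` _ = _) => -[x _ e] _ .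
  have [Ix|nIx] := pselect (I x).
    by have [[_ ne] _] := fb x b0 Ix nI; apply: ne.
  by have [_ [_ ne]] := fb 0 x (cut_zero pa Icut) nIx; apply: ne.
apply/seteqP; split=> d.
  move=> [x [_ xb] <-]; split; [exact: (le0 paN) | exact/(elementary_le ef)].
move=> [_ db]; apply: contrapT => nd.
have nr x : f x <> d.
  move=> e; apply: nd; exists x => //; split; first exact: (le0 pa).
  by apply/(elementary_le ef); rewrite e.
have dD : Def N [set y | y <= d] by dfn_tac.
have [D dD0 hD] := coded_trace ef0 codf0 (trace_coded ef codf dD).
have Db0 : D (f0 b0).
  apply: (trace_induction pa ef0 Icut IG0 dD0) => //.
    apply/hD; first exact: cut_zero.
    by split; [exact: cut_zero | rewrite /= (elementary0 ef); exact: (le0 paN)].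
  move=> x Ix /hD - /(_ Ix) [_ /= xd].
  have Ix1 := cut_succ pa Icut Ix.
  apply/hD => //; split=> //=; rewrite (elementaryD ef) (elementary1 ef).
  by have [/nr|] := proj1 (le_eqVlt paN _ _) xd.
have [_ /= bd] := proj2 (hD _ Ib0) Db0.
by apply: (nr b0); exact: (leanti paN).
Qed.

End Fills.


(** * Filling extensions code all sets definable at level two *)

Lemma linked_inst (M N : structure) (f : M -> N) P P'
    (T : nat -> (nat -> M) -> M) (T' : nat -> (nat -> N) -> N) :
  linked f P P' -> (forall i, dterm (linked f) (T i) (T' i)) ->
  linked f (fun v => P (fun i => T i v)) (fun v => P' (fun i => T' i v)).
Proof.
move=> [phi [w [h h']]] hT.
have -> : (fun v => P (fun i => T i v)) =
    (fun v => sat (fun i => (if odd i then fun _ => w i./2 else T i./2) v) phi).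
  apply/funext => v; rewrite h /sat; congr sat2; apply/funext => i.
  by rewrite /mix; case: odd.
have -> : (fun v => P' (fun i => T' i v)) =
    (fun v => sat (fun i => (if odd i then fun _ => f (w i./2) else T' i./2) v) phi).
  apply/funext => v; rewrite h' /sat; congr sat2; apply/funext => i.
  by rewrite /mix; case: odd.
apply: (dc_sat2 (linked_class f)) => [[]|i].
by case: odd; [exact: linked_const | exact: hT].
Qed.

Lemma is_Sigma0 S (phi : formula S) : is_Sigma 0 phi -> bounded phi.
Proof. by move=> h; inversion h. Qed.

Lemma is_Pi0 S (phi : formula S) : is_Pi 0 phi -> bounded phi.
Proof. by move=> h; inversion h. Qed.

Section LevelTwo.
Context (M N : structure) (f : M -> N) (pa : PA M) (I : set M) (Icut : cut I).
Context (Iadd : closed_under sadd I) (Imul : closed_under smul I).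
Local Open Scope pa_scope.

Let A : structure := Defs.restrict pa Icut Iadd Imul.
Let params := {Y : set A | [set @Defs.incl M I pa Icut Iadd Imul @^-1` X | X in Cod I] Y}.
Let V (Y : params) : set A := sval Y.
Let inc (a : A) : M := sval a.
Let val (v : nat -> A) : nat -> M := fun i => inc (v i).
Let C := linked_class f.

Let inc_inj a b : inc a = inc b -> a = b.
Proof. exact: sval_inj. Qed.

Let val_scons a v : val (scons a v) = scons (inc a) (val v).
Proof. by apply/funext => -[]. Qed.

Let eval_val v t : inc (eval v t) = eval (val v) t.
Proof. by elim: t => //= t1 <- t2 <-. Qed.

Let eval_lift (a : M) v t : eval (scons a v) (Defs.lift t) = eval v t.
Proof. by elim: t => //= t1 -> t2 ->. Qed.

Let below_term t (v : nat -> A) a : a <= eval (val v) t -> exists a' : A, inc a' = a.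
Proof.
rewrite -eval_val => h.
by exists (exist _ a (cut_le pa Icut (svalP (eval v t)) h)).
Qed.

Definition bounded_rep (R : (nat -> A) -> Prop) :=
  exists P Q, linked f P Q /\ forall v, R v <-> P (val v).

Lemma bounded_repP (phi : formula params) :
  bounded phi -> bounded_rep (fun v => sat2 V v phi).
Proof.
elim=> {phi} /=.
- exists (fun _ => False), (fun _ => False).
  by split=> //; exact: (dc_bot C).
- move=> t1 t2; exists (fun v => eval v t1 = eval v t2), (fun v => eval v t1 = eval v t2).
  split=> [|v]; first exact: (dc_eqt C).
  by rewrite -!eval_val; split=> [->//|]; exact: inc_inj.
- move=> t1 t2; exists (fun v => eval v t1 <= eval v t2), (fun v => eval v t1 <= eval v t2).
  by split=> [|v]; [exact: (dc_let C) | rewrite -!eval_val].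
- move=> [Y [X [D dD eX] eY]] t; have [D' hD] := Def_lset f dD.
  exists (fun v => D (eval v t)), (fun v => D' (eval v t)).
  split=> [|v]; first by apply: (dc_mem C hD); exact: (dterm_eval C).
  rewrite /V /= -eval_val -eY -eX /preimage /=; split=> [[]|] //; split=> //.
  exact: svalP.
- move=> p q _ [P [Q [hP eP]]] _ [P' [Q' [hP' eP']]].
  exists (fun v => P v -> P' v), (fun v => Q v -> Q' v).
  by split=> [|v]; [exact: (dc_imp C) | rewrite eP eP'].
- move=> p q _ [P [Q [hP eP]]] _ [P' [Q' [hP' eP']]].
  exists (fun v => P v /\ P' v), (fun v => Q v /\ Q' v).
  by split=> [|v]; [exact: (dc_and C) | rewrite eP eP'].
- move=> p q _ [P [Q [hP eP]]] _ [P' [Q' [hP' eP']]].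
  exists (fun v => P v \/ P' v), (fun v => Q v \/ Q' v).
  by split=> [|v]; [exact: (dc_or C) | rewrite eP eP'].
- move=> t p _ [P [Q [hP eP]]].
  exists (fun v => forall a, scons a v 0%N <= eval (scons a v) (Defs.lift t) -> P (scons a v)).
  exists (fun v => forall a, scons a v 0%N <= eval (scons a v) (Defs.lift t) -> Q (scons a v)).
  split=> [|v].
    apply: (dc_sall C (P := fun v => v 0%N <= eval v (Defs.lift t) -> P v)
      (P' := fun v => v 0%N <= eval v (Defs.lift t) -> Q v)).
    by apply: (dc_imp C) => //; exact: (dc_let C (Var 0)).
  split=> h a.
    rewrite eval_lift => aa; have [a' ea] := below_term (aa : a <= _).
    rewrite -ea -val_scons -eP; apply: h.
    change (inc a' <= inc (eval (scons a' v) (Defs.lift t))).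
    by rewrite eval_val val_scons eval_lift ea.
  move=> aa; rewrite eP val_scons; apply: h; rewrite eval_lift.
  have {}aa : inc a <= inc (eval (scons (a : A) v) (Defs.lift t)) by [].
  by rewrite eval_val val_scons eval_lift in aa.
- move=> t p _ [P [Q [hP eP]]].
  exists (fun v => exists a, scons a v 0%N <= eval (scons a v) (Defs.lift t) /\ P (scons a v)).
  exists (fun v => exists a, scons a v 0%N <= eval (scons a v) (Defs.lift t) /\ Q (scons a v)).
  split=> [|v].
    apply: (dc_sex C (P := fun v => v 0%N <= eval v (Defs.lift t) /\ P v)
      (P' := fun v => v 0%N <= eval v (Defs.lift t) /\ Q v)).
    by apply: (dc_and C) => //; exact: (dc_let C (Var 0)).
  split=> -[a [aa hp]].
    have {}aa : inc a <= inc (eval (scons (a : A) v) (Defs.lift t)) by [].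
    rewrite eval_val val_scons eval_lift in aa.
    by exists (inc a); rewrite eval_lift -val_scons -eP.
  rewrite eval_lift in aa; have [a' ea] := below_term (aa : a <= _).
  exists a'; split; last by rewrite eP val_scons ea.
  change (inc a' <= inc (eval (scons a' v) (Defs.lift t))).
  by rewrite eval_val val_scons eval_lift ea.
Qed.

(** A block of unbounded quantifiers over [I] is one quantifier over [I] in
    front of a definable predicate, because that predicate may be taken
    monotone: the block is bounded by its largest member. *)
Definition Pi1_rep (R : (nat -> A) -> Prop) :=
  exists P Q, [/\ linked f P Q,
    forall v z z', z <= z' -> P (scons z' v) -> P (scons z v) &
    forall v, R v <-> forall z, I z -> P (scons z (val v))].

Lemma Pi1_rep_all R : Pi1_rep R -> Pi1_rep (fun v => forall a, R (scons a v)).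
Proof.
move=> [P [Q [hP anti eP]]].
exists (fun v => forall a, a <= v 0%N -> P (scons (v 0%N) (scons a (fun i => v i.+1)))).
exists (fun v => forall a, a <= v 0%N -> Q (scons (v 0%N) (scons a (fun i => v i.+1)))).
split.
- apply: (dc_all C); apply: (dc_imp C); first by dfn_tac.
  have := dc_ren C (fun i => match i with 0%N => 1%N | 1%N => 0%N | _ => i end) hP.
  by congr linked; apply/funext => v; [congr P | congr Q]; apply/funext => -[|[]].
- move=> v z z' zz' h a az; apply: (anti _ _ _ zz'); apply: h; exact: (letr pa az zz').
- move=> v; split=> [h z Iz a az|h a] /=.
    have Ia := cut_le pa Icut Iz az.
    by have /eP := h (exist _ a Ia); rewrite val_scons; apply.
  apply/eP => z Iz; rewrite val_scons.
  have [m [zm am im]] := le_max pa z (inc a); apply: (anti _ _ _ zm).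
  by apply: (h m) => //; case: im => -> //; exact: svalP.
Qed.

Definition Sigma2_rep (R : (nat -> A) -> Prop) :=
  exists P Q, [/\ linked f P Q,
    forall v u z z', z <= z' -> P (scons u (scons z' v)) -> P (scons u (scons z v)),
    forall v u u' z, u <= u' -> P (scons u (scons z v)) -> P (scons u' (scons z v)) &
    forall v, R v <-> exists2 u, I u & forall z, I z -> P (scons u (scons z (val v)))].

Lemma Pi1_Sigma2_rep R : Pi1_rep R -> Sigma2_rep R.
Proof.
move=> [P [Q [hP anti eP]]].
exists (fun v => P (fun i => v i.+1)), (fun v => Q (fun i => v i.+1)); split.
- exact: (dc_ren C succn hP).
- by move=> v u z z'; exact: anti.
- by [].
- move=> v; rewrite eP; split=> [h|[u _ h] //].
  by exists 0 => //; exact: cut_zero.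
Qed.

Lemma Sigma2_rep_ex R : Sigma2_rep R -> Sigma2_rep (fun v => exists a, R (scons a v)).
Proof.
move=> [P [Q [hP anti mono eP]]].
exists (fun v => exists a, a <= v 0%N /\
  P (scons (v 0%N) (scons (v 1%N) (scons a (fun i => v i.+2))))).
exists (fun v => exists a, a <= v 0%N /\
  Q (scons (v 0%N) (scons (v 1%N) (scons a (fun i => v i.+2))))).
have lk : linked f (fun v => exists a, a <= v 0%N /\
    P (scons (v 0%N) (scons (v 1%N) (scons a (fun i => v i.+2)))))
  (fun v => exists a, a <= v 0%N /\
    Q (scons (v 0%N) (scons (v 1%N) (scons a (fun i => v i.+2))))).
  apply: (dc_ex C); apply: (dc_and C); first by dfn_tac.
  have := dc_ren C (fun i => match i with 0%N => 1%N | 1%N => 2 | 2 => 0%N | _ => i end) hP.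
  by congr linked; apply/funext => v; [congr P | congr Q]; apply/funext => -[|[|[]]].
split=> //=.
- by move=> v u z z' zz' [a [au h]]; exists a; split=> //; exact: (anti _ _ _ _ zz' h).
- move=> v u u' z uu' [a [au h]]; exists a; split; first exact: (letr pa au uu').
  exact: (mono _ _ _ _ uu' h).
- move=> v; split.
    move=> [a /eP [u Iu h]]; have [m [um am im]] := le_max pa u (inc a).
    exists m => [|z Iz]; first by case: im => -> //; exact: svalP.
    exists (inc a); split=> //; apply: (mono _ _ _ _ um); rewrite -val_scons; exact: h.
  (* The witness below [u] is chosen at a level beyond [I], so that it serves
     all levels in [I]. *)
  move=> [u Iu h].
  have dD : Def M [set z | exists a, a <= u /\ P (scons u (scons z (scons a (val v))))].
    have := linked_inst (T := fun i w => scons u (scons (w 0%N) (val v)) i)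
      (T' := fun i w => scons u (scons (w 0%N) (val v)) i) (linked_left lk).
    by rewrite Def_dfn; apply=> -[|[|i]] /=; dfn_tac.
  have [c nc /(_ c (lerefl pa c)) [a [au ha]]] := overspill pa dD Icut h.
  exists (exist _ a (cut_le pa Icut Iu au)); apply/eP; exists u => // z Iz.
  rewrite val_scons; apply: (anti _ _ _ _ _ ha); exact: (ltW pa (cut_lt pa Icut Iz nc)).
Qed.

Lemma bounded_Pi1_rep R : bounded_rep R -> Pi1_rep R.
Proof.
move=> [P [Q [hP eP]]]; exists (fun v => P (fun i => v i.+1)), (fun v => Q (fun i => v i.+1)).
split=> //; first exact: (dc_ren C succn hP).
move=> v; rewrite eP; split=> [//|/(_ 0)]; apply; exact: cut_zero.
Qed.

Lemma bounded_rep_not R : bounded_rep R -> bounded_rep (fun v => ~ R v).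
Proof.
move=> [P [Q [hP eP]]]; exists (fun v => ~ P v), (fun v => ~ Q v).
by split=> [|v]; [exact: (dc_not C) | rewrite eP].
Qed.

Let not_ex T (R : T -> Prop) : (~ exists a, R a) = forall a, ~ R a.
Proof. by apply/propext; exact: (iff_sym (forallNP _)). Qed.

Let not_all T (R : T -> Prop) : (~ forall a, R a) = exists a, ~ R a.
Proof. by apply/propext; exact: (iff_sym (existsNP _)). Qed.

Lemma Pi1_repP (phi : formula params) :
  (is_Pi 1 phi -> Pi1_rep (fun v => sat2 V v phi)) /\
  (is_Sigma 1 phi -> Pi1_rep (fun v => ~ sat2 V v phi)).
Proof.
split.
- move e : 1%N => n h; elim: h e => // {}n {}phi.
    move=> + [e]; rewrite -e => /is_Sigma0 hp.
    by apply: bounded_Pi1_rep; exact: bounded_repP.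
  by move=> _ IH /IH /Pi1_rep_all.
- move e : 1%N => n h; elim: h e => // {}n {}phi.
    move=> + [e]; rewrite -e => /is_Pi0 hp.
    by apply: bounded_Pi1_rep; apply: bounded_rep_not; exact: bounded_repP.
  by move=> _ IH /IH /Pi1_rep_all; under eq_fun do rewrite -not_ex.
Qed.

Lemma Sigma2_repP (phi : formula params) :
  (is_Sigma 2 phi -> Sigma2_rep (fun v => sat2 V v phi)) /\
  (is_Pi 2 phi -> Sigma2_rep (fun v => ~ sat2 V v phi)).
Proof.
split.
- move e : 2 => n h; elim: h e => // {}n {}phi.
    by move=> + [e]; rewrite -e => /(proj1 (Pi1_repP _)) /Pi1_Sigma2_rep.
  by move=> _ IH /IH /Sigma2_rep_ex.
- move e : 2 => n h; elim: h e => // {}n {}phi.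
    by move=> + [e]; rewrite -e => /(proj2 (Pi1_repP _)) /Pi1_Sigma2_rep.
  by move=> _ IH /IH /Sigma2_rep_ex; under eq_fun do rewrite -not_all.
Qed.

Lemma Sigma2_matrix R (v : nat -> A) : Sigma2_rep R -> exists F G,
  [/\ linked f (fun w => F (w 0%N) (w 1%N) (w 2)) (fun w => G (w 0%N) (w 1%N) (w 2)),
      forall u z z' x, z <= z' -> F u z' x -> F u z x &
      forall a, R (scons a v) <-> exists2 u, I u & forall z, I z -> F u z (inc a)].
Proof.
move=> [P [Q [hP anti _ eP]]].
exists (fun u z x => P (scons u (scons z (scons x (val v))))).
exists (fun u z x => Q (scons u (scons z (scons x (fun i => f (val v i)))))).
split=> [|u z z' x|a].
- apply: (linked_inst
    (T := fun i w => scons (w 0%N) (scons (w 1%N) (scons (w 2) (val v))) i)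
    (T' := fun i w => scons (w 0%N) (scons (w 1%N) (scons (w 2) (fun j => f (val v j)))) i) hP).
  by move=> -[|[|[|i]]] /=; dfn_tac.
- exact: anti.
- by rewrite eP val_scons.
Qed.

Context (ef : elementary f) (XX : set (set M)) (IG : GCIS f = I).
Context (codf : Cod_ext_eq f I XX) (b : N) (fb : fills f I b).

Section Matrix.
Context (F : M -> M -> M -> Prop) (G : N -> N -> N -> Prop).
Context (FG : linked f (fun w => F (w 0%N) (w 1%N) (w 2)) (fun w => G (w 0%N) (w 1%N) (w 2))).

Let paN := PA_elementary ef pa.

(** Below some element of [M] outside [I], hence at the filling element, the
    matrix has the value it takes throughout [I]. *)
Lemma matrix_true u a : (forall z, I z -> F u z a) -> G (f u) b (f a).
Proof.
move=> h; have dD : Def M [set z | F u z a].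
  have := linked_inst (T := fun i w => scons u (scons (w 0%N) (fun _ => a)) i)
    (T' := fun i w => scons u (scons (w 0%N) (fun _ => a)) i) (linked_left FG).
  by rewrite Def_dfn; apply=> -[|[|i]] /=; dfn_tac.
have [c nc hc] := overspill pa dD Icut h.
have lk : linked f (fun w => forall z, z <= w 1%N -> F (w 0%N) z (w 2))
    (fun w => forall z, z <= w 1%N -> G (w 0%N) z (w 2)).
  apply: (dc_all C); apply: (dc_imp C); first by dfn_tac.
  exact: (dc_ren C (fun i => match i with 0%N => 1%N | 1%N => 0%N | _ => i.+1 end) FG).
apply: (proj1 (linked_transfer (scons u (scons c (fun _ => a))) ef lk) hc).
by have [_ [+ _]] := fb (cut_zero pa Icut) nc; apply.
Qed.

Lemma matrix_false u z a : (forall u z z' x, z <= z' -> F u z' x -> F u z x) ->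
  I z -> ~ F u z a -> ~ G (f u) b (f a).
Proof.
move=> anti Iz nF.
have lk : linked f (fun w => forall z, w 1%N <= z -> ~ F (w 0%N) z (w 2))
    (fun w => forall z, w 1%N <= z -> ~ G (w 0%N) z (w 2)).
  apply: (dc_all C); apply: (dc_imp C); first by dfn_tac.
  apply: (dc_not C).
  exact: (dc_ren C (fun i => match i with 0%N => 1%N | 1%N => 0%N | _ => i.+1 end) FG).
apply: (proj1 (linked_transfer (scons u (scons z (fun _ => a))) ef lk)).
  by move=> z' /= zz' F'; apply: nF; exact: (anti _ _ _ _ zz' F').
have [c nc] := cut_out Icut.
by have [[+ _] _] := fb Iz nc; apply.
Qed.

End Matrix.

(** In the extension, a set that is definable in both ways is decided by
    comparing which of the two least witnesses below the filling element
    comes first. *)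
Theorem filling_Delta2 : Delta_Def_cut 2 pa Icut Iadd Imul `<=` XX.
Proof.
move=> _ [D [[phi [v [sphi eD]]] [psi [w [ppsi eD']]]] <-].
have paN := PA_elementary ef pa.
have [F1 [G1 [FG1 anti1 h1]]] := Sigma2_matrix v (proj1 (Sigma2_repP phi) sphi).
have [F2 [G2 [FG2 anti2 h2]]] := Sigma2_matrix w (proj2 (Sigma2_repP psi) ppsi).
have {eD}h1 a : D a <-> exists2 u, I u & forall z, I z -> F1 u z (inc a).
  by rewrite -h1 eD.
have {eD'}h2 a : ~ D a <-> exists2 u, I u & forall z, I z -> F2 u z (inc a).
  by rewrite -h2 eD'.
have G1b : linked (@id N) (fun v => G1 (v 0%N) b (v 1%N)) (fun v => G1 (v 0%N) b (v 1%N)).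
  apply: (linked_inst (T := fun i w => scons (w 0%N) (scons b (fun _ => w 1%N)) i)
    (T' := fun i w => scons (w 0%N) (scons b (fun _ => w 1%N)) i) (linked_right FG1)).
  by move=> -[|[|i]] /=; dfn_tac.
have G2b : linked (@id N) (fun v => G2 (v 0%N) b (v 1%N)) (fun v => G2 (v 0%N) b (v 1%N)).
  apply: (linked_inst (T := fun i w => scons (w 0%N) (scons b (fun _ => w 1%N)) i)
    (T' := fun i w => scons (w 0%N) (scons b (fun _ => w 1%N)) i) (linked_right FG2)).
  by move=> -[|[|i]] /=; dfn_tac.
have dZ : Def N [set y | exists u, G1 u b y /\ forall u', u' <= u -> ~ G2 u' b y].
  rewrite Def_dfn /mkset; pose K := linked_class (@id N).
  apply: (dc_ex K); apply: (dc_and K).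
    exact: G1b.
  apply: (dc_all K); apply: (dc_imp K); first by dfn_tac.
  apply: (dc_not K).
  exact: (dc_ren K (fun i => if i is 0%N then 0%N else i.+1) G2b).
have := trace_coded ef codf dZ; congr XX.
apply/seteqP; split=> a /=.
  move=> [Ia [u [hu1 hu2]]]; exists (exist _ a Ia : A) => //; apply: contrapT.
  move=> /[dup] nD /h2 [u0 Iu0 /(matrix_true FG2) t2].
  have uu0 : u < f u0 by apply/(ltnle paN) => /hu2.
  have [u1 [Iu1 _ e]] := GCIS_below pa ef Icut IG Iu0 (ltW paN uu0).
  have : ~ forall z, I z -> F1 u1 z a by move=> h; apply: nD; apply/h1; exists u1.
  move=> /existsNP [z /not_implyP [Iz]] /(matrix_false FG1 anti1 Iz).
  by rewrite -e.
move=> [a' Da' <-]; split; first exact: (svalP a').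
have /h1 [u Iu /(matrix_true FG1) t1] := Da'.
exists (f u); split=> // u' u'u.
have [u1 [Iu1 _ ->]] := GCIS_below pa ef Icut IG Iu u'u.
have : ~ forall z, I z -> F2 u1 z (inc a').
  move=> h; suff : ~ D a' by [].
  by apply/h2; exists u1.
by move=> /existsNP [z /not_implyP [Iz]] /(matrix_false FG2 anti2 Iz).
Qed.

End LevelTwo.


(** * Countably generated models *)

(** The Tarski-Vaught test; induction makes least witnesses sufficient, and
    these are definable from the parameters. *)
Lemma tarski_vaught (M : structure) (pa : PA M) (K : set M) : K !=set0 ->
  (forall phi (v : nat -> M) a, (forall i, K (v i)) -> sat (scons a v) phi ->
     (forall y, sat (scons y v) phi -> sle a y) -> K a) ->
  exists (S : structure) (g : S -> M), elementary g /\ range g = K.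
Proof.
move=> [k0 Kk0] Kleast.
have Kuniq (phi : fo_formula) v a : (forall i, K (v i)) -> sat (scons a v) phi ->
    (forall y, sat (scons y v) phi -> y = a) -> K a.
  by move=> Kv sa ua; apply: (Kleast phi v a) => // y /ua ->; exact: (lerefl pa).
have K0 : K szero.
  by apply: (Kuniq (Eq (Var 0) Zero) (fun _ => k0)).
have K1 : K sone.
  by apply: (Kuniq (Eq (Var 0) One) (fun _ => k0)).
have KD x y : K x -> K y -> K (sadd x y).
  move=> Kx Ky; apply: (Kuniq (Eq (Var 0) (Add (Var 1) (Var 2))) (scons x (fun _ => y))) => //.
  by case.
have KM x y : K x -> K y -> K (smul x y).
  move=> Kx Ky; apply: (Kuniq (Eq (Var 0) (Mul (Var 1) (Var 2))) (scons x (fun _ => y))) => //.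
  by case.
pose S := @Structure {x : M | K x} (exist K szero K0) (exist K sone K1)
  (fun x y => exist K (sadd (sval x) (sval y)) (KD _ _ (svalP x) (svalP y)))
  (fun x y => exist K (smul (sval x) (sval y)) (KM _ _ (svalP x) (svalP y)))
  (fun x y => sle (sval x) (sval y)).
pose g (x : S) : M := sval x.
have rg : range g = K.
  apply/seteqP; split=> [_ [x _ <-]|x Kx]; first exact: (svalP x).
  by exists (exist K x Kx).
exists S, g; split=> //.
have ginj a b : g a = g b -> a = b by exact: sval_inj.
have geval v t : g (eval v t) = eval (fun i => g (v i)) t.
  by elim: t => //= t1 <- t2 <-.
have gscons a v : (fun i => g (scons a v i)) = scons (g a) (fun i => g (v i)).
  by apply/funext => -[].
have wit (phi : fo_formula) (v : nat -> S) a : sat (scons a (fun i => g (v i))) phi ->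
    exists a' : S, sat (scons (g a') (fun i => g (v i))) phi.
  move=> sa.
  have dD : Def M [set x | sat (scons x (fun i => g (v i))) phi].
    by exists phi, (fun i => g (v i)).
  have [|b hb lb] := least pa dD; first by exists a.
  have Kb : K b by apply: (Kleast phi _ b _ hb lb) => i; exact: (svalP (v i)).
  by exists (exist K b Kb).
elim=> //=.
- move=> t1 t2 v; rewrite /sat /= -!geval; split=> [->//|]; exact: ginj.
- by move=> t1 t2 v; rewrite /sat /= -!geval.
- by move=> p hp q hq v; rewrite /sat /= -!/(sat _ _) hp hq.
- by move=> p hp q hq v; rewrite /sat /= -!/(sat _ _) hp hq.
- by move=> p hp q hq v; rewrite /sat /= -!/(sat _ _) hp hq.
- move=> p hp v; split=> h a; last by apply/hp; rewrite gscons; exact: h.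
  apply: contrapT => na; have [|a' []] := wit (Imp p Bot) v a; first exact: na.
  by rewrite -gscons; apply/hp; exact: h.
- move=> p hp v; split=> -[a h].
    by exists (g a); rewrite -gscons; exact/hp.
  have [a' h'] := wit p v a h.
  by exists a'; apply/hp; rewrite gscons.
Qed.

Definition least_solution (M : structure) (phi : fo_formula) (v : nat -> M) (a : M) :=
  sat (scons a v) phi /\ forall y, sat (scons y v) phi -> sle a y.

Lemma linked_least (M N : structure) (f : M -> N) (phi : fo_formula) (v : nat -> M) :
  linked f (fun u => least_solution phi v (u 0))
    (fun u => least_solution phi (fun i => f (v i)) (u 0)).
Proof.
have C := linked_class f; have L := linked_sat f v phi.
apply: (dc_and C) => //; apply: (dc_all C); apply: (dc_imp C) => //.
by dfn_tac.
Qed.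

(** The members of [M] that lie in an elementary substructure of [N] form an
    elementary substructure of [M]; it is [M] itself if it contains [A]. *)
Lemma generates_trans (M N : structure) (f : M -> N) (pa : PA M) (A : set M) (Y : set N) :
  elementary f -> generates A -> generates (Y `|` range f) ->
  generates (Y `|` f @` A).
Proof.
move=> ef genM genN K g eg sub; have paN := PA_elementary ef pa.
apply: (genN K g) => // y [Yy|]; first by apply: sub; left.
move=> [m _ <-]; apply: contrapT => nm {genN y}.
pose L := [set x | range g (f x)].
have [||S [h [eh rh]]] := tarski_vaught pa (K := L).
- exists szero, szero => //.
  by rewrite (elementary0 (proj1 eg)) (elementary0 ef).
- move=> phi v a /= Lv sa la.
  have /choice [w hw] : forall i, exists k, g k = f (v i).
    by move=> i; have [k _ e] := Lv i; exists k.
  have ew : (fun i => g (w i)) = fun i => f (v i) by apply/funext.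
  have lfa : least_solution phi (fun i => f (v i)) (f a).
    exact/(linked_transfer (fun _ => a) ef (linked_least f phi v)).
  have lg := linked_least g phi w; rewrite ew in lg.
  have [k hk] : exists k, least_solution phi w k.
    apply/(linked_transfer (fun _ => szero) (proj1 eg)
      (dc_ex (linked_class g) (P := fun a _ => least_solution phi w a)
      (P' := fun a _ => least_solution phi (fun i => f (v i)) a) lg)).
    by exists (f a).
  have /(linked_transfer (fun _ => k) (proj1 eg) lg) [sk lk] := hk.
  by exists k => //; apply: (leanti paN); [apply: lk; case: lfa | case: lfa => _; apply].
- apply: (genM S h).
    split=> //; exists m => -[x _ e]; apply: nm.
    have : L m by rewrite -rh; exists x.
    by [].
  move=> a Aa; rewrite rh; apply: sub; right; by exists a.
Qed.

Fixpoint code_term (t : term) : GenTree.tree nat :=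
  match t with
  | Var i => GenTree.Leaf i
  | Zero => GenTree.Node 0 [::]
  | One => GenTree.Node 1 [::]
  | Add a b => GenTree.Node 2 [:: code_term a; code_term b]
  | Mul a b => GenTree.Node 3 [:: code_term a; code_term b]
  end.

Fixpoint code_formula (phi : formula nat) : GenTree.tree nat :=
  match phi with
  | Bot => GenTree.Node 0 [::]
  | Eq a b => GenTree.Node 1 [:: code_term a; code_term b]
  | Le a b => GenTree.Node 2 [:: code_term a; code_term b]
  | Defs.Mem n t => GenTree.Node 3 [:: GenTree.Leaf n; code_term t]
  | Imp p q => GenTree.Node 4 [:: code_formula p; code_formula q]
  | And p q => GenTree.Node 5 [:: code_formula p; code_formula q]
  | Or p q => GenTree.Node 6 [:: code_formula p; code_formula q]
  | All p => GenTree.Node 7 [:: code_formula p]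
  | Ex p => GenTree.Node 8 [:: code_formula p]
  end.

Lemma code_term_inj : injective code_term.
Proof.
elim=> [i||| a ha b hb|a ha b hb] [j||| c d|c d] //=.
- by case=> ->.
- by case=> /ha -> /hb ->.
- by case=> /ha -> /hb ->.
Qed.

Lemma code_formula_inj : injective code_formula.
Proof.
elim=> [|a b|a b|n t|p hp q hq|p hp q hq|p hp q hq|p hp|p hp]
       [|c d|c d|m u|p' q'|p' q'|p' q'|p'|p'] //=.
- by case=> /code_term_inj -> /code_term_inj ->.
- by case=> /code_term_inj -> /code_term_inj ->.
- by case=> -> /code_term_inj ->.
- by case=> /hp -> /hq ->.
- by case=> /hp -> /hq ->.
- by case=> /hp -> /hq ->.
- by case=> /hp ->.
- by case=> /hp ->.
Qed.

Lemma formula_enum : exists F : nat -> formula nat, forall phi, exists n, F n = phi.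
Proof.
exists (fun n => if pselect (exists phi, pickle (code_formula phi) = n) is left h
                 then sval (cid h) else Bot).
move=> phi; exists (pickle (code_formula phi)).
case: pselect => [h|[]]; last by exists phi.
by case: cid => psi /= /(pcan_inj pickleK) /code_formula_inj.
Qed.

Section Enumeration.
Context (M : structure) (pa : PA M) (X J : set M) (Xcount : countable X).
Context (J0 : J !=set0) (Jpair : forall a b, J a -> J b -> J (cpair a b)).
Context (gen : generates (X `|` J)).
Local Open Scope pa_scope.

(** The formulas of the class below mention only countably many generators and
    one further parameter, from [J]; pairing merges two such parameters. *)
Lemma countably_generated_Def : exists W : nat -> set M, (forall n, Def M (W n)) /\
  forall D, Def M D -> exists n j, J j /\ D = [set x | W n (cpair j x)].
Proof.
have [e einj] := elimT (countable_injP _) Xcount.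
pose V n := [set x | X x /\ e x = n].
have VX x : X x -> V (e x) = [set x].
  move=> Xx; apply/seteqP; split=> [y [Xy eyx]|y ->]; last by [].
  by apply: einj => //; apply/mem_set.
have dV n : Def M (V n).
  have [[x Vx]|none] := pselect (V n !=set0).
    rewrite -(proj2 Vx) (VX x (proj1 Vx)) (_ : [set x] = [set y | y = x]) //.
    by dfn_tac.
  suff -> : V n = [set y | False] by dfn_tac.
  by apply/seteqP; split=> // y Vy; apply: none; exists y.
have [j0 Jj0] := J0.
pose C := defined_by V V (fun w w' => exists j, [/\ J j, w = fun _ => j & w' = fun _ => j]).
pose pairT s t := Add (Mul (Add s t) (Add s t)) s.
have dC : defclass C.
  apply: defined_by_class; first by exists (fun _ => j0), (fun _ => j0), j0.
  move=> _ _ _ _ [j1 [Jj1 -> ->]] [j2 [Jj2 -> ->]].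
  exists (fun _ => cpair j1 j2), (fun _ => cpair j1 j2).
  pose t k (phi : formula nat) := Ex (Ex (And (Eq (Var 3) (pairT (Var 1) (Var 0)))
    (ren (remix (fun i => i.*2.+2) (fun _ => k)) phi))).
  have ht k phi v : (k < 2)%N ->
      sat2 V (mix v (fun _ => cpair j1 j2)) (t k phi) =
      sat2 V (mix v (fun _ => if k is 0%N then j2 else j1)) phi.
    move=> k2; have step a b : (fun i => scons b (scons a (mix v (fun _ => cpair j1 j2)))
          (remix (fun i => i.*2.+2) (fun _ => k) i)) =
        mix v (fun _ => if k is 0%N then b else a).
      apply: mix_ext => i; rewrite ?remix_even ?remix_odd ?mix_even ?mix_odd /=.
        by rewrite mix_even.
      by case: k k2 => [|[]].
    apply/propext; rewrite /t /=; split.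
      by move=> [a [b [/(cpair_inj pa) [<- <-]]]]; rewrite sat2_ren step.
    by move=> h; exists j1, j2; rewrite sat2_ren step.
  exists (t 1%N), (t 0%N); split=> [|phi]; last by split=> v; rewrite ht.
  by exists (cpair j1 j2); split=> //; exact: Jpair.
pose K := [set m | dterm C (fun _ => m) (fun _ => m)].
have Ksat (phi : fo_formula) v : (forall i, K (v i)) ->
    C (fun u => sat (scons (u 0%N) v) phi) (fun u => sat (scons (u 0%N) v) phi).
  move=> Kv; apply: (dc_sat dC phi (F := fun i _ => v i) (F' := fun i _ => v i)) => //.
  exact: (dterm_var dC).
have XK x : X x -> K x.
  move=> Xx; exists (Defs.Mem (e x) (Var 0)), (fun _ => j0), (fun _ => j0).
  by split=> [|v|v]; [exists j0 | rewrite /= VX | rewrite /= VX].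
have JK j : J j -> K j.
  move=> Jj; exists (Eq (Var 0) (Var 1)), (fun _ => j), (fun _ => j).
  by split=> //; exists j.
have [S [g [eg rg]]] : exists (S : structure) (g : S -> M), elementary g /\ range g = K.
  apply: (tarski_vaught pa); first by exists j0; exact: JK.
  move=> phi v a Kv sa la; rewrite /K /= /dterm.
  have -> : (fun u : nat -> M => u 0%N = a) = (fun u => sat (scons (u 0%N) v) phi /\
      forall y, sat (scons y v) phi -> u 0%N <= y).
    apply/funext => u; apply/propext; split=> [-> //|[su lu]].
    by apply: (leanti pa); [exact: lu | exact: la].
  apply: (dc_and dC); first exact: Ksat.
  apply: (dc_all dC); apply: (dc_imp dC); first exact: Ksat.
  by apply: (dc_le dC); exact: (dterm_var dC).
have KT m : K m.
  apply: contrapT => nK; apply: (gen (K := S) (g := g)).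
    by split=> //; exists m; rewrite rg.
  by rewrite rg => x [/XK|/JK].
have [F hF] := formula_enum.
exists (fun n => [set z | exists j x, z = cpair j x /\ sat2 V (mix (fun _ => x) (fun _ => j)) (F n)]).
split=> [n|D [phi [v eD]]].
  dfn_tac.
  have -> : (fun u : nat -> M => sat2 V (mix (fun _ => u 0%N) (fun _ => u 1%N)) (F n)) =
     (fun u => sat2 V (fun i => u (odd i : nat)) (F n)).
    by apply/funext => u; congr sat2; apply/funext => i; rewrite /mix; case: odd.
  apply: (dc_sat2 (linked_class id)) => [s|i]; first exact/Def_dfn/dV.
  exact: (dterm_var (linked_class id)).
have [Phi [w [_ [[j [Jj -> _]] hPhi _]]]] := Ksat phi v (fun i => KT (v i)).
have [n hn] := hF Phi; exists n, j; split=> //; rewrite eD.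
apply/seteqP; split=> x /=.
  by rewrite (hPhi (fun _ => x)) => h; exists j, x; rewrite hn.
by move=> [j' [x' [/(cpair_inj pa) [<- <-]]]]; rewrite hn -hPhi.
Qed.

End Enumeration.


(** * Digits *)

Section Digits.
Context (M : structure) (pa : PA M).
Local Open Scope pa_scope.

(** [B (cpair j t)] tells whether digit [j] of [t] is one, where numbers are read
    as nested pairs [cpair q e + 1] with last digit [e].  Appending a digit is
    then a polynomial operation, and reading digits needs no division. *)
Definition digits (B : set M) (v : M) := forall q e, cpair q e + 1 < v ->
  (B (cpair 0 (cpair q e + 1)) <-> e = 1) /\
  forall j, B (cpair (j + 1) (cpair q e + 1)) <-> B (cpair j q).

Lemma digits_ex v : exists2 B, Def M B & digits B v.
Proof.
pose T (c : set M) t j := exists q e, t = cpair q e + 1 /\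
  ((j = 0 /\ e = 1) \/ exists j', j = j' + 1 /\ (j' <= q /\ c (cpair q j'))).
have [||m [s h]] := @recursion M pa T v.
- by rewrite /T /codes; dfn_tac.
- move=> c c' x y agree [q [e [ex k]]]; exists q, e; split=> //.
  case: k => [|[j' [ej [jq cj]]]]; first by left.
  right; exists j'; split=> //; split=> //; apply/agree => //.
  by rewrite ex; apply: (le_add2 pa); [exact: le_cpairl | exact: (lerefl pa)].
exists [set z | exists j t, z = cpair j t /\ (j <= t /\ codes m s (cpair t j))].
  by rewrite /codes; dfn_tac.
have BE j t : [set z | exists j t, z = cpair j t /\ (j <= t /\ codes m s (cpair t j))] (cpair j t) <->
    j <= t /\ codes m s (cpair t j).
  split=> [[j' [t' [/(cpair_inj pa) [<- <-]]]] //|k].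
  by exists j, t.
move=> q e tv; split=> [|j]; rewrite !BE.
  rewrite h //; last exact: (le0 pa).
  split=> [[_ [q' [e' [/(addIr pa) /(cpair_inj pa) [_ <-]]]]]|->].
    case=> [[_ ->//]|[j' [/esym /(PA_succ_neq0 pa) //]]].
  by split; [exact: (le0 pa) | exists q, 1; split=> //; left].
split=> [[jt]|[jq cj]].
  rewrite h // => -[q' [e' [/(addIr pa) /(cpair_inj pa) [<- _]]]].
  by case=> [[/(PA_succ_neq0 pa)//]|[j' [/(addIr pa) <-]]].
have jt : j + 1 <= cpair q e + 1.
  apply: (le_add2 pa); last exact: (lerefl pa).
  exact: (letr pa jq (le_cpairl pa _ _)).
split=> //; rewrite h //; exists q, e; split=> //; right; by exists j.
Qed.

(** All subsets of [0, u) have codes up to [h], so [h] plays the role of the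
    exponential of [u]. *)
Definition full (B : set M) u h :=
  forall m s, exists t, t <= h /\ forall j, j < u -> (B (cpair j t) <-> codes m s j).

Lemma full_code B u h D : full B u h -> Def M D ->
  exists2 t, t <= h & forall j, j < u -> (B (cpair j t) <-> D j).
Proof.
move=> hF dD; have [m [s hms]] := coding pa u dD; have [t [th ht]] := hF m s.
by exists t => // j ju; rewrite ht // hms.
Qed.

Lemma full_zero B : full B 0 0.
Proof. by move=> m s; exists 0; split=> [|j /(ltlt0 pa)]; first exact: (lerefl pa). Qed.

(** The bound grows polynomially: this is what makes the coding available in
    a cut that is only known to be closed under addition and multiplication. *)
Lemma full_succ B v u h : Def M B -> digits B v -> cpair h 1 + 1 < v ->
  full B u h -> full B (u + 1) (cpair h 1 + 1).
Proof.
move=> dB hB hv hF m s.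
have dD : Def M [set j | codes m s (j + 1)] by rewrite /codes; dfn_tac.
have [t th ht] := full_code hF dD.
have [e [e1 he]] : exists e : M, e <= 1 /\ (e = 1 <-> codes m s 0).
  have [c0|n0] := pselect (codes m s 0); first by exists 1; split=> //; exact: (lerefl pa).
  exists 0; split; first exact: (le0 pa).
  by split=> // e; exfalso; apply: (PA_succ_neq0 pa (x := 0)); rewrite -e (PA_add0 pa).
have te : cpair t e + 1 <= cpair h 1 + 1.
  by apply: (le_add2 pa (cpair_mono pa th e1)); exact: (lerefl pa).
have tv : cpair t e + 1 < v.
  by apply: (leltr pa te hv).
have [h0 hS] := hB t e tv.
exists (cpair t e + 1); split=> // j ju.
case: (zero_or_succ pa j) ju => [->|[i ->]] ju; first by rewrite h0.
rewrite hS ht //; exact: (ltSle pa ju).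
Qed.

End Digits.

(** * Choosing an element of prescribed value in every large class *)

Section Construction.
Context (M N : structure) (f : M -> N) (pa : PA M) (ef : elementary f).
Context (I : set M) (Icut : cut I) (IG : GCIS f = I).
Context (Iadd : closed_under sadd I) (Imul : closed_under smul I).
Local Open Scope pa_scope.

Context (trace_Sigma1 : forall D, Def M D -> exists2 Z, Def N Z &
  forall a, I a -> (Z (f a) <-> exists2 x, I x & D (cpair a x))).

Let paN := PA_elementary ef pa.
Let Ipair a b : I a -> I b -> I (cpair a b).
Proof. exact: cut_cpair. Qed.

(** The bounds of [full] that lie in [I] determine a bounded initial segment
    unless they exist throughout; so [I] is closed under exponentiation. *)
Lemma full_in_cut : exists2 B, Def M B & forall u, I u -> exists2 h, I h & full B u h.
Proof.
have [v nv] := cut_out Icut; have [B dB hB] := digits_ex pa v.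
exists B => //.
have dD : Def M [set z | exists u h, z = cpair u h /\ full B u h].
  by rewrite /full /codes; dfn_tac.
have [Z dZ hZ] := trace_Sigma1 dD.
have zI u : I u -> (Z (f u) <-> exists2 h, I h & full B u h).
  move=> /hZ ->; split=> [[h Ih [u' [h' [/(cpair_inj pa) [<- <-] k]]]]|[h Ih k]].
    by exists h.
  by exists h => //; exists u, h.
move=> u Iu; apply/zI => //; apply: (trace_induction pa ef Icut IG dZ) => //.
  apply/zI; first exact: cut_zero.
  by exists 0; [exact: cut_zero | exact: full_zero].
move=> x Ix /zI - /(_ Ix) [h Ih k]; apply/zI; first exact: cut_succ.
have Ih' : I (cpair h 1 + 1) by apply: cut_succ => //; apply: Ipair => //; exact: cut_one.
exists (cpair h 1 + 1) => //; apply: (full_succ pa dB hB) k.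
exact: (cut_lt pa Icut).
Qed.

Section Selector.
Context (A : set M) (dA : Def M A).

Definition similar r x y := forall j, j < r -> (A (cpair j x) <-> A (cpair j y)).

(** Each element [x] takes the least value [r] that no smaller element of its
    class at level [r] has taken.  A class at level [r] that never gets the value
    [r] injects into the numbers below [r], so it is bounded in [I]. *)
Lemma selector : exists H : set M, [/\ Def M H,
  forall x r r', I x -> H (cpair x r) -> H (cpair x r') -> r = r' &
  forall r y, I r -> I y ->
    (forall u, I u -> exists x, [/\ I x, u < x & similar r x y]) ->
    exists x, [/\ I x, r <= x, similar r x y & H (cpair x r)]].
Proof.
have [v nv] := cut_out Icut.
pose free (c : set M) x r := forall x', x' < x -> similar r x' x ->
  ~ (r <= x' /\ c (cpair x' r)).
pose T c x r := free c x r /\ forall r', r' < r -> ~ free c x r'.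
have [||m [s hc]] := @recursion M pa T v.
- by rewrite /T /free /similar /codes; dfn_tac.
- move=> c c' x y agree.
  have fE r : free c x r <-> free c' x r.
    split=> h x' x'x sim [rx' cx]; apply: (h x' x'x sim); split=> //; exact/agree.
  by move=> [/fE h1 h2]; split=> // r' /h2; rewrite fE.
pose H := [set z | exists x r, z = cpair x r /\ (r <= x /\ codes m s (cpair x r))].
have dH : Def M H by rewrite /H /codes; dfn_tac.
have HE x r : H (cpair x r) <-> r <= x /\ codes m s (cpair x r).
  by split=> [[x' [r' [/(cpair_inj pa) [<- <-]]]] //|k]; exists x, r.
have HT x r : I x -> (H (cpair x r) <-> r <= x /\ T (codes m s) x r).
  move=> Ix; rewrite HE; split=> -[rx]; rewrite hc //; exact: (cut_lt pa Icut).
exists H; split=> //.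
  move=> x r r' Ix /(HT _ _ Ix) [_ [fr lr]] /(HT _ _ Ix) [_ [fr' lr']].
  by apply: (leanti pa); apply/(lenlt pa); [move=> /lr | move=> /lr'].
move=> r y Ir Iy unb; apply: contrapT => none.
have low x : I x -> r <= x -> similar r x y -> exists r', r' < r /\ H (cpair x r').
  move=> Ix rx sim.
  have fr : free (codes m s) x r.
    move=> x' x'x sim' [rx' cx]; apply: none; exists x'.
    have Ix' : I x' := cut_le pa Icut Ix (ltW pa x'x).
    by split=> //; [move=> j jr; rewrite sim' // sim | apply/HE].
  have dF : Def M [set r | free (codes m s) x r] by rewrite /free /similar /codes; dfn_tac.
  have [|r1 fr1 lr1] := least pa dF; first by exists r.
  have r1r : r1 <= r by exact: lr1.
  have Hr1 : H (cpair x r1).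
    apply/HT => //; split; first exact: (letr pa r1r rx).
    by split=> // r' r'r1 /lr1 /(lenlt pa).
  exists r1; split=> //; case/(le_eqVlt pa): r1r => [e|//].
  by exfalso; apply: none; exists x; split=> //; rewrite -e.
pose D := [set z | exists r' x, z = cpair r' x /\ (r <= x /\ (similar r x y /\ H (cpair x r')))].
have dD : Def M D by rewrite /D /similar; dfn_tac.
have DE r' x : D (cpair r' x) <-> r <= x /\ (similar r x y /\ H (cpair x r')).
  by split=> [[r1 [x1 [/(cpair_inj pa) [<- <-]]]] //|k]; exists r', x.
have [Z dZ hZ] := trace_Sigma1 dD.
have [D' hD'] := Def_lset f dD.
have dD' := lset_Def hD'.
have DT r' x : D (cpair r' x) <-> D' (cpair (f r') (f x)).
  by rewrite (lset_transfer _ ef hD') (elementary_pair ef).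
(* The bounds for all elements with values below [r]: everything outside [I] is
   one, hence some element of [I] is. *)
pose W := [set w | forall r', r' < f r -> Z r' -> exists x, x <= w /\ D' (cpair r' x)].
have dW : Def N W by rewrite /W; dfn_tac.
have cutN := cut_image pa ef Icut IG.
have outW w : ~ (f @` I) w -> W w.
  move=> nw r' /(ltW paN) /(GCIS_below pa ef Icut IG Ir) [r1 [Ir1 _ ->]].
  move=> /hZ - /(_ Ir1) [x Ix /DT k]; exists (f x); split=> //.
  by apply/(ltW paN)/(cut_lt paN cutN) => //; exists x.
have [|w Ww lw] := least paN dW.
  by have [c nc] := cut_out cutN; exists c; exact: outW.
have [w1 Iw1 ew] : (f @` I) w.
  apply: contrapT => nw; case: (zero_or_succ paN w) => [w0|[w' ew]].
    by apply: nw; rewrite w0; exists 0; [exact: cut_zero | exact: elementary0].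
  have /outW /lw : ~ (f @` I) w' by move=> /(cut_succ paN cutN); rewrite -ew.
  by rewrite ew => /(ltirr paN).
have [z [rz wz iz]] := le_max pa r w1.
have Iz : I z by case: iz => ->.
have [x [Ix zx simx]] := unb z Iz.
have [r1 [r1r Hx]] := low x Ix (letr pa rz (ltW pa zx)) simx.
have Ir1 : I r1 := cut_le pa Icut Ir (ltW pa r1r).
have Zr1 : Z (f r1).
  apply/hZ => //; exists x => //; apply/DE; split; last by split.
  exact: (letr pa rz (ltW pa zx)).
have fr1r : f r1 < f r by apply/(elementary_lt ef).
have [x2] := Ww _ fr1r Zr1; rewrite -ew.
move=> [/(GCIS_below pa ef Icut IG Iw1) [x3 [Ix3 x3w ->]] /DT /DE [_ [sim3 H3]]].
have x3x : x3 < x by apply: (leltr pa x3w); exact: (leltr pa wz zx).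
have [_ [fx _]] := proj1 (HT _ _ Ix) Hx.
apply: (fx x3 x3x); last exact/HE.
move=> j jr1; have jr : j < r := ltletr pa jr1 (ltW pa r1r).
by rewrite sim3 // simx.
Qed.

End Selector.
(** * Families of sets and the bits that select them *)

(** The bits [s] select from each row of the family [A] the row or its complement.
    A good state is one with the finite intersection property, in the uniform
    form that all selections below any [u] in [I] meet, above [u], inside [I]. *)
Definition good (A : set M) (s : set N) := [/\ Def M A, Def N s &
  forall u, I u -> exists x, [/\ I x, u < x &
    forall j, j < u -> (A (cpair j x) <-> s (f j))]].

(** What the first state selects, the second selects as well. *)
Definition refines (A : set M) (s : set N) (A' : set M) (s' : set N) :=
  forall j, I j -> exists j', [/\ I j', forall x, A (cpair j x) <-> A' (cpair j' x) &
    s (f j) <-> s' (f j')].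

Definition join (A B : set M) : set M := [set z | exists j x,
  (z = cpair (cpair j 0) x /\ A (cpair j x)) \/ (z = cpair (cpair j 1) x /\ B (cpair j x))].

Lemma Def_join A B : Def M A -> Def M B -> Def M (join A B).
Proof. by move=> dA dB; rewrite /join; dfn_tac. Qed.

Lemma zero_neq1 (K : structure) : PA K -> (0 : K) <> 1.
Proof.
move=> paK e; apply: (PA_succ_neq0 paK (x := 0)); by rewrite -{1}e (PA_add0 paK).
Qed.

Lemma join0 A B j x : join A B (cpair (cpair j 0) x) <-> A (cpair j x).
Proof.
split=> [[j' [x' []]]|h]; last by exists j, x; left.
  by move=> [/(cpair_inj pa) [/(cpair_inj pa) [<- _] <-]].
by move=> [/(cpair_inj pa) [/(cpair_inj pa) [_ /(zero_neq1 pa)]]].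
Qed.

Lemma join1 A B j x : join A B (cpair (cpair j 1) x) <-> B (cpair j x).
Proof.
split=> [[j' [x' []]]|h]; last by exists j, x; right.
  by move=> [/(cpair_inj pa) [/(cpair_inj pa) [_ /esym /(zero_neq1 pa)]]].
by move=> [/(cpair_inj pa) [/(cpair_inj pa) [<- _] <-]].
Qed.

Lemma refines_join0 A B s s' : (forall j, I j -> (s (f j) <-> s' (f (cpair j 0)))) ->
  refines A s (join A B) s'.
Proof.
move=> h j Ij; exists (cpair j 0); split=> [|x|]; last exact: h.
  by apply: Ipair => //; exact: cut_zero.
by rewrite join0.
Qed.

Lemma refines_join1 A B t s' : (forall j, I j -> (t (f j) <-> s' (f (cpair j 1)))) ->
  refines B t (join A B) s'.
Proof.
move=> h j Ij; exists (cpair j 1); split=> [|x|]; last exact: h.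
  by apply: Ipair => //; exact: cut_one.
by rewrite join1.
Qed.

Let cpair_lt (j e u : M) : cpair j e < u -> j < u.
Proof. by apply: (leltr pa); exact: le_cpairl. Qed.

Let cutN := cut_image pa ef Icut IG.

(** Bits for a further family.  Which patterns are realized beyond [u] is a
    definable set with one quantifier over [I], so [N] knows it, and the
    patterns have codes in [I]; overspill in [N] gives one pattern for all
    rows. *)
Lemma decide A s B : good A s -> Def M B -> exists t A' s',
  [/\ Def N t, good A' s', refines A s A' s' & refines B t A' s'].
Proof.
move=> [dA ds gA] dB; pose C := join A B; have dC : Def M C := Def_join dA dB.
have [E dE hE] := full_in_cut.
pose R := [set z | exists t u x, z = cpair (cpair t u) x /\
  (u < x /\ forall j, j < u -> (C (cpair j x) <-> E (cpair j t)))].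
have dR : Def M R by rewrite /R; dfn_tac.
have [Z dZ hZ] := trace_Sigma1 dR.
have RE t u : I t -> I u -> (Z (f (cpair t u)) <-> exists2 x, I x &
    u < x /\ forall j, j < u -> (C (cpair j x) <-> E (cpair j t))).
  move=> It Iu; rewrite hZ; last exact: Ipair.
  split=> -[x Ix]; last by move=> k; exists x => //; exists t, u, x.
  by move=> [t' [u' [x' [/(cpair_inj pa) [/(cpair_inj pa) [<- <-] <-]] k]]]; exists x.
have [E' lE] := Def_lset f dE; have dE' := lset_Def lE.
(* [codes m s0] is a candidate for the new bits up to [u].  The condition on [h]
   forces the code [t] of the pattern into [I] when [u'] is in [I]. *)
pose Q := [set u | exists m s0, forall u', u' <= u ->
  (forall j, cpair j 0 < u' -> (s j <-> codes m s0 (cpair j 0))) /\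
  exists t, (forall h, full E' u' h -> t <= h) /\ (Z (cpair t u') /\
    forall j, j < u' -> (codes m s0 j <-> E' (cpair j t)))].
have dQ : Def N Q by rewrite /Q /full /codes; dfn_tac.
have codesE m s0 j : codes m s0 j <-> codes (f m) (f s0) (f j).
  apply: (linked_transfer (P := fun w => codes (w 0%N) (w 1%N) (w 2))
    (P' := fun w => codes (w 0%N) (w 1%N) (w 2)) (scons m (scons s0 (fun _ => j))) ef).
  by rewrite /codes; dfn_tac.
have EE j t : E (cpair j t) <-> E' (cpair (f j) (f t)).
  by rewrite (lset_transfer _ ef lE) (elementary_pair ef).
have Q_in u : I u -> Q (f u).
  move=> Iu; have [x [Ix ux hx]] := gA u Iu.
  have dCx : Def M [set j | C (cpair j x)] by dfn_tac.
  have [m [s0 hs0]] := coding pa u dCx.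
  exists (f m), (f s0) => u' /(GCIS_below pa ef Icut IG Iu) [u1 [Iu1 u1u ->]]; split.
    move=> j ju; have /(ltW paN) : j < f u1 by apply: (leltr paN _ ju); exact: le_cpairl.
    move=> /(GCIS_below pa ef Icut IG Iu1) [j1 [Ij1 _ ej]]; rewrite ej in ju *.
    have {}ju : cpair j1 0 < u1.
      by apply/(elementary_lt ef); rewrite (elementary_pair ef) (elementary0 ef).
    have j0u := ltletr pa ju u1u.
    rewrite -(elementary0 ef) -(elementary_pair ef) -codesE hs0 // /mkset /C join0 hx //.
    exact: cpair_lt j0u.
  have [h Ih hh] := hE _ Iu1.
  have dP : Def M [set t | forall j, j < u1 -> (E (cpair j t) <-> codes m s0 j)].
    by rewrite /codes; dfn_tac.
  have [|t ht lt] := least pa dP.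
    by have [t [_ ht]] := hh m s0; exists t.
  have tmin h' : full E u1 h' -> t <= h'.
    by move=> /(_ m s0) [t' [t'h /lt tt']]; exact: (letr pa tt' t'h).
  have It : I t := cut_le pa Icut Ih (tmin h hh).
  exists (f t); split; first last.
    split.
      rewrite -(elementary_pair ef); apply/RE => //; exists x => //.
      split; first by apply: (leltr pa u1u).
      by move=> j ju; rewrite ht // hs0 //; exact: (ltletr pa ju u1u).
    move=> j /[dup] ju /(ltW paN) /(GCIS_below pa ef Icut IG Iu1) [j1 [Ij1 _ ej]].
    rewrite ej -codesE -EE ht //; apply/(elementary_lt ef); by rewrite -ej.
  have := linked_transfer (P := fun w => forall h, full E (w 0%N) h -> w 1%N <= h)
    (P' := fun w => forall h, full E' (w 0%N) h -> w 1%N <= h) (scons u1 (fun _ => t)) ef.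
  by case=> [|+ _]; [rewrite /full /codes; dfn_tac | apply].
have [c nc Qc] : exists2 c, ~ (f @` I) c & Q c.
  have [|c nc hc] := overspill paN dQ cutN; first by move=> _ [u Iu <-]; exact: Q_in.
  by exists c => //; apply: hc; exact: (lerefl paN).
have [m [s0 hs0]] := Qc.
have below u : I u -> f u <= c.
  by move=> Iu; apply/(ltW paN)/(cut_lt paN cutN) => //; exists u.
have {}hs0 u : I u -> _ := fun Iu => hs0 (f u) (below u Iu).
exists [set j | codes m s0 (cpair j 1)], C, (codes m s0); split.
- by rewrite /codes; dfn_tac.
- split=> //; first by rewrite /codes; dfn_tac.
  move=> u Iu; have [_ [t [tmin [Zt ht]]]] := hs0 u Iu.
  have [h Ih hh] := hE _ Iu.
  have th : t <= f h.
    apply: tmin.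
    have := linked_transfer (P := fun w => full E (w 0%N) (w 1%N))
      (P' := fun w => full E' (w 0%N) (w 1%N)) (scons u (fun _ => h)) ef.
    by case=> [|+ _]; [rewrite /full /codes; dfn_tac | apply].
  have [t1 [It1 _ et]] := GCIS_below pa ef Icut IG Ih th.
  move: Zt; rewrite et -(elementary_pair ef) => /RE [//|//|x Ix [ux hx]].
  exists x; split=> // j ju; rewrite hx // EE -et ht //.
  exact/(elementary_lt ef).
- apply: refines_join0 => j Ij.
  have Ij0 : I (cpair j 0) by apply: Ipair => //; exact: cut_zero.
  have [h _] := hs0 _ (cut_succ pa Icut Ij0).
  have -> : f (cpair j 0) = cpair (f j) 0 by rewrite (elementary_pair ef) (elementary0 ef).
  apply: h; rewrite (elementaryD ef) (elementary_pair ef) (elementary0 ef) (elementary1 ef).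
  exact: (lt_succ paN).
- apply: refines_join1 => j Ij.
  by rewrite (elementary_pair ef) (elementary1 ef).
Qed.

(** A family whose selected bits are a prescribed set [X]: row [j] consists of
    the [x] whose selector value codes a pattern that contains [j]. *)
Lemma encode A s X : good A s -> Def N X -> exists B A' s',
  [/\ Def M B, good A' s', refines A s A' s' & refines B X A' s'].
Proof.
move=> [dA ds gA] dX; have [E dE hE] := full_in_cut.
have [E' lE] := Def_lset f dE.
have [H [dH Hfun Hex]] := selector dA.
pose B := [set z | exists j x t u, z = cpair j x /\
  (H (cpair x (cpair t u)) /\ E (cpair j t))].
have dB : Def M B by rewrite /B; dfn_tac.
have BE j x : B (cpair j x) <-> exists t u, H (cpair x (cpair t u)) /\ E (cpair j t).
  split=> [[j' [x' [t [u [/(cpair_inj pa) [<- <-] k]]]]]|[t [u k]]]; first by exists t, u.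
  by exists j, x, t, u.
pose s' := [set k | (exists j, k = cpair j 0 /\ s j) \/ (exists j, k = cpair j 1 /\ X j)].
have ds' : Def N s' by rewrite /s'; dfn_tac.
have s'0 j : s' (cpair j 0) <-> s j.
  split=> [[] [j' [/(cpair_inj paN) [<-]]] //|h]; last by left; exists j.
  by move=> /(zero_neq1 paN).
have s'1 j : s' (cpair j 1) <-> X j.
  split=> [[] [j' [/(cpair_inj paN) [<-]]] //|h]; last by right; exists j.
  by move=> /esym /(zero_neq1 paN).
exists B, (join A B), s'; split=> //; first last.
- by apply: refines_join1 => j Ij; rewrite (elementary_pair ef) (elementary1 ef) s'1.
- by apply: refines_join0 => j Ij; rewrite (elementary_pair ef) (elementary0 ef) s'0.
split=> //; first exact: Def_join.
move=> u Iu; have [h Ih hh] := hE _ Iu.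
have hh' : full E' (f u) (f h).
  have := linked_transfer (P := fun w => full E (w 0%N) (w 1%N))
    (P' := fun w => full E' (w 0%N) (w 1%N)) (scons u (fun _ => h)) ef.
  by case=> [|+ _]; [rewrite /full /codes; dfn_tac | apply].
have [_ /(GCIS_below pa ef Icut IG Ih) [t [It _ ->]] ht] := full_code paN hh' dX.
have Et j : j < u -> (E (cpair j t) <-> X (f j)).
  move=> ju; rewrite (lset_transfer _ ef lE) (elementary_pair ef) ht //.
  exact/(elementary_lt ef).
(* The value [r] carries the pattern [t] and exceeds [u]. *)
pose r := cpair t (u + 1).
have Ir : I r by apply: Ipair => //; exact: cut_succ.
have ur : u < r := le_cpairr pa _ _.
have [y [Iy ry hy]] := gA r Ir.
have [] := Hex r y Ir Iy.
  move=> w Iw; have [z [rz wz iz]] := le_max pa r w.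
  have Iz : I z by case: iz => ->.
  have [x [Ix zx hx]] := gA z Iz; exists x; split=> //; first exact: (leltr pa wz).
  by move=> j jr; rewrite hx ?hy //; exact: (ltletr pa jr rz).
move=> x [Ix rx sim Hx]; exists x; split=> //; first exact: (ltletr pa ur rx).
move=> k ku.
have [[j ek]|n0] := pselect (exists j, k = cpair j 0).
  rewrite ek in ku *; rewrite join0 (elementary_pair ef) (elementary0 ef) s'0.
  have jr : j < r := letr pa (cpair_lt ku) (ltW pa ur).
  by rewrite sim // hy.
have [[j ek]|n1] := pselect (exists j, k = cpair j 1).
  rewrite ek in ku *; rewrite join1 (elementary_pair ef) (elementary1 ef) s'1.
  rewrite BE -(Et _ (cpair_lt ku)); split=> [[t' [u' [H' Ej]]]|Ej]; last by exists t, (u + 1).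
  by have [-> _] := cpair_inj pa (Hfun _ _ _ Ix Hx H').
have Ik : I k := cut_le pa Icut Iu (ltW pa ku).
split.
  by move=> [j [x' [] [/(cpair_inj pa) [e _] _]]]; exfalso; [apply: n0 | apply: n1]; exists j.
have down j e : f k = cpair j e -> exists j1, j = f j1.
  move=> ek; have jk : j <= f k by rewrite ek; exact: le_cpairl.
  by have [j1 [_ _ ->]] := GCIS_below pa ef Icut IG Ik jk; exists j1.
by move=> [] [j [ek _]]; have [j1 ej] := down _ _ ek; exfalso;
  [apply: n0 | apply: n1]; exists j1; apply: (elementary_inj ef);
  rewrite ek ej (elementary_pair ef) ?(elementary0 ef) ?(elementary1 ef).
Qed.

End Construction.


(** * An ultrafilter of sets unbounded in the cut *)

Section Ultrafilter.
Context (M N : structure) (f : M -> N) (pa : PA M) (ef : elementary f).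
Context (I : set M) (Icut : cut I) (IG : GCIS f = I).
Context (Iadd : closed_under sadd I) (Imul : closed_under smul I).
Local Open Scope pa_scope.

Context (trace_Sigma1 : forall D, Def M D -> exists2 Z, Def N Z &
  forall a, I a -> (Z (f a) <-> exists2 x, I x & D (cpair a x))).
Context (W : nat -> set M) (dW : forall n, Def M (W n)).
Context (Wcover : forall D, Def M D -> exists n j, I j /\ D = [set x | W n (cpair j x)]).
Context (X : nat -> set N) (dX : forall n, Def N (X n)).
Context (Xcover : forall D, Def N D -> exists n j, (f @` I) j /\ D = [set x | X n (cpair j x)]).

Let Ipair a b : I a -> I b -> I (cpair a b).
Proof. exact: cut_cpair. Qed.

Let refines := refines f I.
Let good := good f I.

Lemma refines_trans A s A' s' A'' s'' :
  refines A s A' s' -> refines A' s' A'' s'' -> refines A s A'' s''.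
Proof.
move=> h h' j /h [j' [/h' [j'' [Ij'' r' b']] r b]]; exists j''; split=> // [x|].
  by rewrite r.
by rewrite b.
Qed.

(* The parameter [a] of a definable set is absorbed into the row index, so that
   one stage treats the families for all parameters at once. *)
Let sections n : set M := [set z | exists a i x,
  z = cpair (cpair a i) x /\ W n (cpair a (cpair i x))].

Let sectionsE n a i x : sections n (cpair (cpair a i) x) <-> W n (cpair a (cpair i x)).
Proof.
split=> [[a' [i' [x' [/(cpair_inj pa) [/(cpair_inj pa) [<- <-] <-]]]]] //|h].
by exists a, i, x.
Qed.

Lemma stage_step n (st : {p : set M * set N | good p.1 p.2}) :
  exists st' : {p : set M * set N | good p.1 p.2},
  [/\ refines (sval st).1 (sval st).2 (sval st').1 (sval st').2,
      exists2 t, Def N t & refines (sections n) t (sval st').1 (sval st').2 &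
      exists2 B, Def M B & refines B (X n) (sval st').1 (sval st').2].
Proof.
case: st => [[A s] /= g].
have dS : Def M (sections n) by have := dW n; rewrite /sections => d; dfn_tac.
have [t [A1 [s1 [dt g1 r1 rt]]]] := decide pa ef Icut IG Iadd Imul trace_Sigma1 g dS.
have [B [A2 [s2 [dB g2 r2 rB]]]] := encode pa ef Icut IG Iadd Imul trace_Sigma1 g1 (dX n).
exists (exist _ (A2, s2) g2); split=> /=; first exact: (refines_trans r1 r2).
  by exists t => //; exact: (refines_trans rt r2).
by exists B.
Qed.

Lemma stages : exists (A : nat -> set M) (s : nat -> set N),
  [/\ forall n, good (A n) (s n),
      forall n, refines (A n) (s n) (A n.+1) (s n.+1),
      forall n, exists2 t, Def N t & refines (sections n) t (A n.+1) (s n.+1) &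
      forall n, exists2 B, Def M B & refines B (X n) (A n.+1) (s n.+1)].
Proof.
pose p0 : set M * set N := ([set _ | False], [set _ | False]).
have g0 : good p0.1 p0.2.
  split=> [||u Iu] /=; [by dfn_tac | by dfn_tac | exists (u + 1)].
  by split=> //; [exact: cut_succ | exact: (lt_succ pa)].
pose st : nat -> {p : set M * set N | good p.1 p.2} :=
  nat_rect (fun _ => _) (exist _ p0 g0) (fun n p => sval (cid (stage_step n p))).
exists (fun n => (sval (st n)).1), (fun n => (sval (st n)).2).
split=> n; first exact: (svalP (st n)).
- by have [] := svalP (cid (stage_step n (st n))).
- by have [] := svalP (cid (stage_step n (st n))).
- by have [] := svalP (cid (stage_step n (st n))).
Qed.

(** Each definable set occurs as a row at some stage, and two stages never
    disagree, since all selections made up to a stage have common members. *)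
Lemma ultrafilter : exists U : set (set M),
  [/\ forall D, Def M D -> U D \/ U (~` D),
      forall D1 D2 D3 w, U D1 -> U D2 -> U D3 -> I w ->
        exists x, [/\ I x, w < x, D1 x, D2 x & D3 x],
      forall V, Def M V -> exists2 T, Def N T &
        forall i, I i -> (T (f i) <-> U [set x | V (cpair i x)]) &
      forall T, Def N T -> exists2 V, Def M V &
        forall i, I i -> (T (f i) <-> U [set x | V (cpair i x)])].
Proof.
have [A [s [g rS rW rX]]] := stages.
have mono m n : (m <= n)%N -> refines (A m) (s m) (A n) (s n).
  move=> /subnK <-; elim: (n - m)%N => [|k IH].
    by move=> j Ij; exists j.
  by rewrite addSn; exact: (refines_trans IH (rS _)).
pose decided (D : set M) (b : Prop) := exists n j,
  [/\ I j, forall x, D x <-> A n (cpair j x) & b <-> s n (f j)].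
have meet D1 D2 D3 b1 b2 b3 w : decided D1 b1 -> decided D2 b2 -> decided D3 b3 ->
    I w -> exists x, [/\ I x, w < x, D1 x <-> b1, D2 x <-> b2 & D3 x <-> b3].
  move=> [n1 [j1 [I1 r1 e1]]] [n2 [j2 [I2 r2 e2]]] [n3 [j3 [I3 r3 e3]]] Iw.
  pose n := maxn n1 (maxn n2 n3).
  have [|k1 [J1 R1 E1]] := mono n1 n _ j1 I1; first by rewrite leq_max leqnn.
  have [|k2 [J2 R2 E2]] := mono n2 n _ j2 I2; first by rewrite !leq_max leqnn orbT.
  have [|k3 [J3 R3 E3]] := mono n3 n _ j3 I3; first by rewrite !leq_max leqnn !orbT.
  pose u := cpair (cpair k1 k2) (cpair k3 w) + 1.
  have Iu : I u by apply: cut_succ => //; do 2?apply: Ipair; do ?apply: Ipair.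
  have [_ _ /(_ u Iu) [x [Ix ux hx]]] := g n.
  have l1 : k1 < u.
    by apply: (leltr pa _ (lt_succ pa _)); exact: (letr pa (le_cpairl pa _ _) (le_cpairl pa _ _)).
  have l2 : k2 < u.
    by apply: (leltr pa _ (lt_succ pa _)); exact: (letr pa (le_cpairr pa _ _) (le_cpairl pa _ _)).
  have l3 : k3 < u.
    by apply: (leltr pa _ (lt_succ pa _)); exact: (letr pa (le_cpairl pa _ _) (le_cpairr pa _ _)).
  have lw : w < u.
    by apply: (leltr pa _ (lt_succ pa _)); exact: (letr pa (le_cpairr pa _ _) (le_cpairr pa _ _)).
  exists x; split=> //.
  - exact: (letr pa lw (ltW pa ux)).
  - by rewrite r1 R1 e1 E1; exact: hx.
  - by rewrite r2 R2 e2 E2; exact: hx.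
  - by rewrite r3 R3 e3 E3; exact: hx.
have I0 : I 0 by exact: cut_zero.
have sectioned V : Def M V -> exists2 T, Def N T &
    forall i, I i -> decided [set x | V (cpair i x)] (T (f i)).
  move=> /Wcover [n [j [Ij eV]]]; have [t dt rt] := rW n.
  exists [set y | t (cpair (f j) y)]; first by dfn_tac.
  move=> i Ii; have [k [Ik rk ek]] := rt _ (Ipair Ij Ii).
  exists n.+1, k; split=> // [x|]; last by rewrite /= -(elementary_pair ef).
  by rewrite /= -rk sectionsE eV.
have dec D : Def M D -> exists b, decided D b.
  move=> dD; have dV : Def M [set z | exists i x, z = cpair i x /\ D x] by dfn_tac.
  have [T _ /(_ 0 I0) [n [k [Ik rk ek]]]] := sectioned _ dV.
  exists (s n (f k)), n, k; split=> // x; rewrite -rk /=; split=> [h|]; first by exists 0, x.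
  by move=> [i [x' [/(cpair_inj pa) [_ <-]]]].
pose U D := Def M D /\ decided D True.
have UE D b : Def M D -> decided D b -> (b <-> U D).
  move=> dD hD; split=> [hb|[_ hT]].
    split=> //; have [n [k [Ik rk ek]]] := hD; exists n, k; split=> //.
    by rewrite -ek.
  by have [x [_ _ e1 e2 _]] := meet _ _ _ _ _ _ 0 hD hT hT I0; apply/e1/e2.
have dsec V i : Def M V -> Def M [set x | V (cpair i x)] by move=> dV; dfn_tac.
exists U; split=> [D dD|D1 D2 D3 w [_ h1] [_ h2] [_ h3] Iw|V dV|T dT].
- have [b hb] := dec D dD.
  have dC : Def M (~` D) by rewrite /setC; dfn_tac.
  have [c hc] := dec _ dC.
  have [x [_ _ eb ec _]] := meet _ _ _ _ _ _ 0 hb hc hc I0.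
  have [Dx|nDx] := pselect (D x); first by left; apply/(UE _ _ dD hb)/eb.
  by right; apply/(UE _ _ dC hc)/ec.
- have [x [Ix wx e1 e2 e3]] := meet _ _ _ _ _ _ w h1 h2 h3 Iw.
  by exists x; split=> //; [exact/e1 | exact/e2 | exact/e3].
- have [T dT hT] := sectioned V dV; exists T => // i Ii.
  by apply: UE; [exact: dsec | exact: hT].
- have [n [_ [[j Ij <-] eT]]] := Xcover dT; have [B dB rB] := rX n.
  exists [set z | exists i x, z = cpair i x /\ B (cpair (cpair j i) x)]; first by dfn_tac.
  move=> i Ii; apply: UE.
    by apply: dsec; dfn_tac.
  have [k [Ik rk ek]] := rB _ (Ipair Ij Ii).
  exists n.+1, k; split=> // [x|]; last by rewrite eT /= -(elementary_pair ef).
  rewrite /= -rk; split=> [[i' [x' [/(cpair_inj pa) [<- <-]]]] //|h].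
  by exists i, x.
Qed.

End Ultrafilter.


(** * Definable ultrapowers *)

Section Ultrapower.
Context (M : structure) (pa : PA M) (I : set M) (Icut : cut I).
Local Open Scope pa_scope.
Context (U : set (set M)).
Context (U_dec : forall D, Def M D -> U D \/ U (~` D)).
Context (U_meet : forall D1 D2 D3 w, U D1 -> U D2 -> U D3 -> I w ->
  exists x, [/\ I x, w < x, D1 x, D2 x & D3 x]).

Let C := linked_class (@id M).
Let I0 : I 0 := cut_zero pa Icut.

(** The two laws assumed of [U] give the filter laws: a set that violated one
    would have its complement in [U], and the sets involved would not meet. *)
Lemma U_sub2 D1 D2 D : U D1 -> U D2 -> Def M D -> D1 `&` D2 `<=` D -> U D.
Proof.
move=> h1 h2 dD sub; have [//|h3] := U_dec dD.
have [x [_ _ x1 x2 nx]] := U_meet h1 h2 h3 I0.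
by exfalso; apply: nx; apply: sub.
Qed.

Lemma U_sub D1 D : U D1 -> Def M D -> D1 `<=` D -> U D.
Proof. by move=> h1 dD sub; apply: (U_sub2 h1 h1 dD) => x [/sub]. Qed.

Lemma U_unbounded D w : Def M D -> (forall x, I x -> w < x -> D x) -> I w -> U D.
Proof.
move=> dD h Iw; have [//|h'] := U_dec dD.
by have [x [Ix wx nx _ _]] := U_meet h' h' h' Iw; exfalso; apply: nx; exact: h.
Qed.

Definition definable_fun (F : M -> M) : Prop :=
  dterm (dfn M) (fun v => F (v 0%N)) (fun v => F (v 0%N)).

Definition dfun := {F : M -> M | definable_fun F}.

Let app (F : dfun) : M -> M := sval F.

Let dapp (F : dfun) k : dterm (dfn M) (fun v => app F (v k)) (fun v => app F (v k)).
Proof. exact: (dterm_ren C (fun _ => k) (svalP F)). Qed.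

Definition dadd (F G : dfun) : dfun :=
  @exist _ definable_fun (fun a => app F a + app G a) (dterm_add C (dapp F 0) (dapp G 0)).
Definition dmul (F G : dfun) : dfun :=
  @exist _ definable_fun (fun a => app F a * app G a) (dterm_mul C (dapp F 0) (dapp G 0)).
Definition dconst (m : M) : dfun := @exist _ definable_fun (fun _ => m) (dfn_const m).
Definition did : dfun := @exist _ definable_fun (fun a => a) (dterm_var C 0).

Definition germ (F : dfun) : set dfun := [set G | U [set a | app F a = app G a]].

Definition ultra_carrier := {c : set dfun | exists F, c = germ F}.

Definition cls (F : dfun) : ultra_carrier := exist _ (germ F) (ex_intro _ F erefl).

Let dEq F G : Def M [set a | app F a = app G a].
Proof. by rewrite Def_dfn; apply: (dc_eq C); exact: dapp. Qed.

Lemma cls_eq F G : cls F = cls G <-> U [set a | app F a = app G a].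
Proof.
have refl H : U [set a | app H a = app H a].
  by apply: (U_unbounded (w := 0)) => //; exact: dEq.
split=> [e|h].
  have : germ F = germ G by have := congr1 sval e.
  move=> /(congr1 (fun c => c G)) /= eG.
  by have : germ G G := refl G; rewrite -eG.
apply: sval_inj; apply/seteqP; split=> H hH.
  by apply: (U_sub2 h hH) => [|a /= [-> ->]]; first exact: dEq.
by apply: (U_sub2 h hH) => [|a /= [-> ->]]; first exact: dEq.
Qed.

Definition rep (n : ultra_carrier) : dfun := sval (cid (svalP n)).

Lemma clsK n : cls (rep n) = n.
Proof. by apply: sval_inj; rewrite /rep; case: cid. Qed.

Lemma repK F : U [set a | app (rep (cls F)) a = app F a].
Proof. by apply/cls_eq; rewrite clsK. Qed.

Definition ultrapower : structure := @Structure ultra_carrier (cls (dconst 0)) (cls (dconst 1))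
  (fun x y => cls (dadd (rep x) (rep y))) (fun x y => cls (dmul (rep x) (rep y)))
  (fun x y => U [set a | app (rep x) a <= app (rep y) a]).

Let cl (F : dfun) : ultrapower := cls F.

Lemma cls_add F G : (cl F + cl G = cl (dadd F G)).
Proof.
apply/cls_eq; apply: (U_sub2 (repK F) (repK G)) => [|a /= [-> ->] //].
exact: (dEq (dadd _ _) (dadd F G)).
Qed.

Lemma cls_mul F G : (cl F * cl G = cl (dmul F G)).
Proof.
apply/cls_eq; apply: (U_sub2 (repK F) (repK G)) => [|a /= [-> ->] //].
exact: (dEq (dmul _ _) (dmul F G)).
Qed.

Let dLe F G : Def M [set a | app F a <= app G a].
Proof. by rewrite Def_dfn; apply: (dc_le C); exact: dapp. Qed.

Lemma cls_le F G : cl F <= cl G <-> U [set a | app F a <= app G a].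
Proof.
have eqs : U [set a | app (rep (cls F)) a = app F a /\ app (rep (cls G)) a = app G a].
  apply: (U_sub2 (repK F) (repK G)) => [|a [] //].
  by rewrite Def_dfn; apply: (dc_and C); exact: (proj1 (Def_dfn _) (dEq _ _)).
split=> h; apply: (U_sub2 eqs h); try exact: dLe.
  by move=> a /= [[-> ->]].
by move=> a /= [[-> ->]].
Qed.

Let Def_sat (phi : fo_formula) (F : nat -> dfun) :
  Def M [set a | sat (fun i => app (F i) a) phi].
Proof.
rewrite Def_dfn; apply: (dc_sat2 C) => [[]|i]; exact: dapp.
Qed.

Lemma cls_eval t (F : nat -> dfun) :
  exists2 G, eval (fun i => cl (F i)) t = cl G & forall a, app G a = eval (fun i => app (F i) a) t.
Proof.
elim: t => /=.
- by move=> i; exists (F i).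
- by exists (dconst 0).
- by exists (dconst 1).
- move=> t1 [G1 e1 h1] t2 [G2 e2 h2]; exists (dadd G1 G2); first by rewrite e1 e2; exact: cls_add.
  by move=> a; rewrite -h1 -h2.
- move=> t1 [G1 e1 h1] t2 [G2 e2 h2]; exists (dmul G1 G2); first by rewrite e1 e2; exact: cls_mul.
  by move=> a; rewrite -h1 -h2.
Qed.

(** Definable Skolem functions: least witnesses. *)
Lemma skolem (phi : fo_formula) (F : nat -> dfun) : exists G : dfun, forall a,
  (exists y, sat (scons y (fun i => app (F i) a)) phi) ->
  sat (scons (app G a) (fun i => app (F i) a)) phi.
Proof.
pose S a y := sat (scons y (fun i => app (F i) a)) phi.
have dS k l : dfn M (fun v => S (v k) (v l)) (fun v => S (v k) (v l)).
  apply: (dc_sat C phi (F := fun i v => app (F i) (v k)) (F' := fun i v => app (F i) (v k))).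
    exact: (dterm_var C).
  by move=> i; exact: dapp.
have ex a : exists y, ((exists z, S a z) -> S a y) /\ forall z, S a z -> y <= z.
  have dSa : Def M [set y | S a y] by exists phi, (fun i => app (F i) a).
  have [h|h] := pselect (exists z, S a z).
    by have [y Sy ly] := least pa dSa h; exists y.
  by exists 0; split=> // z Sz; exfalso; apply: h; exists z.
have ex' a : exists y, ((exists z, S a z) /\ S a y /\ (forall z, S a z -> y <= z)) \/
    (~ (exists z, S a z) /\ y = 0).
  have [y [h1 h2]] := ex a; have [h|h] := pselect (exists z, S a z); last by exists 0; right.
  by exists y; left; split=> //; split=> //; exact: h1.
have {ex ex'}[G hG] := choice ex'.
have dG : dterm (dfn M) (fun v => G (v 0%N)) (fun v => G (v 0%N)).
  rewrite /dterm.
  have -> : (fun v : nat -> M => v 0%N = G (v 1%N)) = (fun v =>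
      ((exists z, S (v 1%N) z) /\ (S (v 1%N) (v 0%N) /\ (forall z, S (v 1%N) z -> v 0%N <= z))) \/
      (~ (exists z, S (v 1%N) z) /\ v 0%N = 0)).
    apply/funext => v; apply/propext; split=> [->//|h].
    case: h (hG (v 1%N)) => [[e [s l]]|[n ->]] [[e' [s' l']]|[n' ->]] //.
    by apply: (leanti pa); [exact: l | exact: l'].
  apply: (dc_or C).
    apply: (dc_and C); first by apply: (dc_ex C).
    apply: (dc_and C); first exact: dS.
    by apply: (dc_all C); apply: (dc_imp C); [exact: dS | dfn_tac].
  by apply: (dc_and C); [apply: (dc_not C); apply: (dc_ex C) | dfn_tac].
exists (@exist _ definable_fun G dG) => a /= [y Sy].
by case: (hG a) => [[_ []] //|[n _]]; exfalso; apply: n; exists y.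
Qed.

Theorem los (phi : fo_formula) (F : nat -> dfun) :
  sat (fun i => cl (F i)) phi <-> U [set a | sat (fun i => app (F i) a) phi].
Proof.
have consE G (H : nat -> dfun) : scons (cl G) (fun i => cl (H i)) = fun i => cl (scons G H i).
  by apply/funext => -[].
have appE a G (H : nat -> dfun) :
    scons (app G a) (fun i => app (H i) a) = fun i => app (scons G H i) a.
  by apply/funext => -[].
elim: phi F => //=.
- move=> F; split=> [//|h].
  by have [x [_ _ []]] := U_meet h h h I0.
- move=> t1 t2 F; have [G1 e1 h1] := cls_eval t1 F; have [G2 e2 h2] := cls_eval t2 F.
  rewrite /sat /= e1 e2 cls_eq (_ : [set a | app G1 a = app G2 a] =
    [set a | eval (fun i => app (F i) a) t1 = eval (fun i => app (F i) a) t2]) //.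
  by apply/seteqP; split=> a /=; rewrite h1 h2.
- move=> t1 t2 F; have [G1 e1 h1] := cls_eval t1 F; have [G2 e2 h2] := cls_eval t2 F.
  rewrite /sat /= e1 e2; apply: (iff_trans (cls_le G1 G2)).
  rewrite (_ : [set a | app G1 a <= app G2 a] = [set a | eval (fun i => app (F i) a) t1 <= eval (fun i => app (F i) a) t2]) //.
  by apply/seteqP; split=> a /=; rewrite h1 h2.
- move=> p hp q hq F; have dpq := Def_sat (Imp p q) F.
  have [dp dq] := (Def_sat p F, Def_sat q F).
  rewrite /sat /= -!/(sat _ _) hp hq; split=> h.
    have [/h hU|hU] := U_dec dp; first by apply: (U_sub hU dpq) => a /= ha _.
    by apply: (U_sub hU dpq) => a /= ha /ha.
  by move=> hU; apply: (U_sub2 h hU dq) => a [] /=; apply.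
- move=> p hp q hq F; have dpq := Def_sat (And p q) F.
  have [dp dq] := (Def_sat p F, Def_sat q F).
  rewrite /sat /= -!/(sat _ _) hp hq; split=> [[h1 h2]|h].
    exact: (U_sub2 h1 h2 dpq).
  by split; [apply: (U_sub h dp) => a [] | apply: (U_sub h dq) => a []].
- move=> p hp q hq F; have dpq := Def_sat (Or p q) F.
  have [dp dq] := (Def_sat p F, Def_sat q F).
  rewrite /sat /= -!/(sat _ _) hp hq; split=> [[] h|h].
  + by apply: (U_sub h dpq) => a ha; left.
  + by apply: (U_sub h dpq) => a ha; right.
  + have [|h'] := U_dec dp; first by left.
    by right; apply: (U_sub2 h h' dq) => a [] /= [].
- move=> p hp F; have dA := Def_sat (All p) F; rewrite /sat /= -!/(sat _ _).
  split=> [h|h x].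
    have [//|hn] := U_dec dA.
    have [G hG] := skolem (Imp p Bot) F.
    have := h (cl G); rewrite -/(sat _ _) consE hp => h'.
    have [x [_ _ /= /existsNP hx + _]] := U_meet hn h' h' I0.
    rewrite -appE => sx; exfalso.
    exact: (hG x hx sx).
  rewrite -(clsK x) -/(cl _) -/(sat _ _) consE hp.
  apply: (U_sub h (Def_sat _ _)) => a /= ha; rewrite -appE; exact: ha.
- move=> p hp F; have dE := Def_sat (Ex p) F; rewrite /sat /= -!/(sat _ _).
  split=> [[x]|h].
    rewrite -(clsK x) -/(cl _) -/(sat _ _) consE hp => h.
    by apply: (U_sub h dE) => a /=; rewrite -appE => ha; exists (app (rep x) a).
  have [G hG] := skolem p F; exists (cl G).
  rewrite -/(sat _ _) consE hp; apply: (U_sub h (Def_sat _ _)) => a /= ha.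
  by rewrite -appE; exact: hG.
Qed.

Definition ultra_embed (m : M) : ultrapower := cls (dconst m).
Definition ultra_id : ultrapower := cls did.
Local Notation e := ultra_embed.
Local Notation b := ultra_id.

Lemma U_const (P : Prop) : U [set _ | P] <-> P.
Proof.
split=> [h|p]; first by have [x [_ _ //]] := U_meet h h h I0.
have -> : [set _ | P] = [set a : M | a = a] by apply/seteqP; split.
by apply: (U_unbounded (w := 0)) => //; dfn_tac.
Qed.

Lemma ultra_elementary : elementary e.
Proof.
move=> phi v; apply: iff_sym; apply: (iff_trans (los phi (fun i => dconst (v i)))).
exact: (U_const (sat v phi)).
Qed.

Let paN : PA ultrapower := PA_elementary ultra_elementary pa.

Lemma ultra_lset W W' F : lset e W W' -> W' (cl F) <-> U [set a | W (app F a)].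
Proof.
move=> [phi [w [h h']]]; rewrite (h' (fun _ => cl F)).
have -> : mix (fun _ => cl F) (fun i => e (w i)) =
    fun i => cl (mix (fun _ => F) (fun i => dconst (w i)) i).
  by apply/funext => i; rewrite /mix; case: odd.
rewrite los; suff -> : [set a | W (app F a)] =
    [set a | sat (fun i => app (mix (fun _ => F) (fun i => dconst (w i)) i) a) phi] by [].
apply/funext => a; rewrite /= (h (fun _ => app F a)); congr sat.
by apply/funext => i; rewrite /mix; case: odd.
Qed.

Lemma ultra_fills : fills e I b.
Proof.
move=> a c Ia nc; split; apply/(lt_slt paN).
  have -> : e a + 1 = e (a + 1).
    by rewrite (elementaryD ultra_elementary) (elementary1 ultra_elementary).
  by apply/cls_le; apply: (U_unbounded (w := a)).
rewrite (_ : b + 1 = cl (dadd did (dconst 1))); last exact: cls_add.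
apply/cls_le; apply: (U_unbounded (w := 0)) => //.
by move=> x Ix _; exact: (cut_lt pa Icut).
Qed.

Lemma ultra_id_new : ~ range e b.
Proof.
move=> [m _ em]; have [c nc] := cut_out Icut; have [Im|nm] := pselect (I m).
  by have [[_ +] _] := ultra_fills Im nc; apply.
by have [_ [_ +]] := ultra_fills I0 nm; apply.
Qed.

(** The elements below some [c] outside [I] form a set of [U], and a definable
    function is bounded there. *)
Lemma ultra_cofinal : cofinal_extension e.
Proof.
split; first by split; [exact: ultra_elementary | exists b; exact: ultra_id_new].
move=> x; rewrite -(clsK x); set F := rep x; have [c nc] := cut_out Icut.
have [m hm] : exists m, forall a, a < c -> app F a <= m.
  move: {nc}c; apply: (PA_induct pa (D := [set c | exists m, forall a, a < c -> app F a <= m])).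
    rewrite Def_dfn; apply: (dc_ex C); apply: (dc_all C); apply: (dc_imp C); first by dfn_tac.
    by apply: (dc_le C); [exact: dapp | dfn_tac].
    by exists 0 => a /(ltlt0 pa).
  move=> c [m hm]; have [z [mz fz _]] := le_max pa m (app F c).
  exists z => a /(ltSle pa) /(le_eqVlt pa) [->//|/hm h]; exact: (letr pa h mz).
exists m; apply/cls_le; apply: (U_unbounded (w := 0)) => //.
by move=> a Ia _; apply: hm; exact: (cut_lt pa Icut).
Qed.

Definition dpair (F G : dfun) : dfun := dadd (dmul (dadd F G) (dadd F G)) F.

Lemma cls_pair F G : cpair (cl F) (cl G) = cl (dpair F G).
Proof. by rewrite /cpair !(cls_add, cls_mul). Qed.

(** The germ of [F] is the value at the generating germ of the function that
    [F]'s definition defines in the ultrapower. *)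
Lemma ultra_generated : generated_by e b.
Proof.
move=> K g [eg [x nx]] sub; apply: nx; rewrite -(clsK x); set F := rep x.
have dW : Def M [set z | exists a, z = cpair a (app F a)].
  rewrite Def_dfn; apply: (dc_ex C); apply: (dc_eq C); first by dfn_tac.
  by apply: (dterm_pair C); [dfn_tac | exact: dapp].
have [phi [v eW]] := dW.
pose W' := [set y | sat (scons y (fun i => e (v i))) phi].
have lW : lset e [set z | exists a, z = cpair a (app F a)] W'.
  by rewrite eW; exact: linked_sat.
have [k0 _ ek0] : range g b by apply: sub; right.
have /choice [u hu] : forall i, exists k, g k = e (v i).
  by move=> i; have [|k _ ek] := sub (e (v i)); [left; exists (v i) | exists k].
have lK : lset g [set k | sat (scons k u) phi] W'.
  have := linked_sat g u phi; rewrite /lset /W' /=.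
  by rewrite (_ : (fun i => g (u i)) = (fun i => e (v i))) //; apply/funext.
have bF : W' (cpair b (cl F)).
  rewrite [b]/(cl did) cls_pair; apply/(ultra_lset _ lW).
  rewrite (_ : [set a | _] = [set _ | True]) ?U_const //.
  by apply/seteqP; split=> // a _; exists a.
have uniq y : W' (cpair b y) -> y = cl F.
  have := linked_forall ultra_elementary
    (P := fun v => (exists a, cpair (v 0%N) (v 1%N) = cpair a (app F a)) ->
                   (exists a, cpair (v 0%N) (v 2) = cpair a (app F a)) -> v 1%N = v 2)
    (P' := fun v => W' (cpair (v 0%N) (v 1%N)) -> W' (cpair (v 0%N) (v 2)) -> v 1%N = v 2).
  move=> h hy; apply: (h _ _ (scons b (scons y (fun _ => cl F)))) => //.
    have CC := linked_class e.
    apply: (dc_imp CC); first by apply: (dc_mem CC lW); dfn_tac.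
    apply: (dc_imp CC); first by apply: (dc_mem CC lW); dfn_tac.
    by dfn_tac.
  by move=> w [a /(cpair_inj pa) [-> ->]] [a' /(cpair_inj pa) [-> ->]].
have CK := linked_class g.
have lk : linked g (fun w => exists k, sat (scons (cpair (w 0%N) k) u) phi)
    (fun w => exists y, W' (cpair (w 0%N) y)).
  by apply: (dc_ex CK); apply: (dc_mem CK lK); dfn_tac.
have [k hk] : exists k, sat (scons (cpair k0 k) u) phi.
  apply/(linked_transfer (fun _ => k0) eg lk); exists (cl F); by rewrite ek0.
exists k => //; apply: uniq; rewrite -ek0 -(elementary_pair eg).
exact: (proj1 (lset_transfer _ eg lK) hk).
Qed.

Context (XX : set (set M)) (XXsub : forall X, XX X -> X `<=` I).
Context (U_XX : forall V, Def M V -> XX [set i | I i /\ U [set x | V (cpair i x)]]).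
Context (XX_U : forall X, XX X -> exists2 V, Def M V &
  forall i, I i -> (X i <-> U [set x | V (cpair i x)])).

(** By Los's theorem, coded sets of the ultrapower are those that arise by asking
    of each section of a definable set whether it belongs to [U]. *)
Lemma ultra_Cod : Cod_ext_eq e I XX.
Proof.
apply/seteqP; split=> [_ [D [phi [v eD]] <-]|_ [X hX <-]].
  pose G i := rep (v i).
  pose V := [set z | exists i a, z = cpair i a /\ sat (scons i (fun j => app (G j) a)) phi].
  have dV : Def M V.
    rewrite Def_dfn; apply: (dc_ex C); apply: (dc_ex C); apply: (dc_and C); first by dfn_tac.
    apply: (dc_sat C phi (F := fun i v => app (G i) (v 0%N))
      (F' := fun i v => app (G i) (v 0%N))); first exact: (dterm_var C).
    by move=> i; exact: dapp.
  exists [set i | I i /\ U [set x | V (cpair i x)]]; first exact: U_XX.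
  have key i : D (e i) <-> U [set x | V (cpair i x)].
    have -> : [set x | V (cpair i x)] =
        [set x | sat (fun j => app (scons (dconst i) G j) x) phi].
      have E x : scons i (fun j => app (G j) x) = fun j => app (scons (dconst i) G j) x.
        by apply/funext => -[].
      apply/seteqP; split=> x /=; rewrite -E; last by exists i, x.
      by move=> [i' [x' [/(cpair_inj pa) [<- <-]]]].
    rewrite -los eD /=; suff -> : scons (e i) v = fun j => cl (scons (dconst i) G j) by [].
    by apply/funext => -[|j] //=; rewrite /cl clsK.
  apply/seteqP; split=> x.
    by move=> [i [Ii /key Di] <-]; split=> //; exists i.
  by move=> [[i Ii <-] /key Di]; exists i.
have [V dV hV] := XX_U hX; have [V' lV] := Def_lset e dV.
have dV' := lset_Def lV.
exists [set n | V' (cpair n b)]; first by dfn_tac.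
have key i : I i -> (V' (cpair (e i) b) <-> X i).
  move=> Ii; rewrite [e i]/(cl (dconst i)) [b]/(cl did) cls_pair.
  by apply: (iff_trans (ultra_lset _ lV)); apply: iff_sym; exact: hV.
apply/seteqP; split=> x.
  by move=> [[i Ii <-] /= /key Xi]; exists i => //; exact: Xi.
by move=> [i Xi <-]; have Ii := XXsub hX Xi; split; [exists i | exact/key].
Qed.

End Ultrapower.


(** * The equivalence *)

(** An existential quantifier over [I] in front of a coded set, hence a definition
    at level one; level two contains it on both sides. *)
Lemma Delta2_projection (M : structure) (I : set M) (pa : PA M) (Icut : cut I)
    (Iadd : closed_under sadd I) (Imul : closed_under smul I) D : Def M D ->
  Delta_Def_cut 2 pa Icut Iadd Imul [set a | I a /\ exists2 x, I x & D (cpair a x)].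
Proof.
move=> dD; pose A := Defs.restrict pa Icut Iadd Imul.
have hY : [set @Defs.incl M I pa Icut Iadd Imul @^-1` X | X in Cod I]
    [set a : A | D (sval a)].
  exists (I `&` D); first by exists D.
  by apply/seteqP; split=> a; [case | move=> Da; split=> //; exact: (svalP a)].
pose Y : {Y : set A | [set @Defs.incl M I pa Icut Iadd Imul @^-1` X | X in Cod I] Y} :=
  exist _ _ hY.
pose phi := Ex (Defs.Mem Y (Add (Mul (Add (Var 1) (Var 0)) (Add (Var 1) (Var 0))) (Var 1))).
exists [set a : A | exists x : A, D (cpair (sval a) (sval x))].
  by split; exists phi, (fun _ => szero); split=> //; do ![constructor].
apply/seteqP; split=> [_ [a [x Dx] <-]|a [Ia [x Ix Dx]]].
  split; first exact: (svalP a).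
  by exists (sval x) => //; exact: (svalP x).
exists (exist _ a Ia : A) => //.
by exists (exist _ x Ix : A).
Qed.

Section Existence.
Context (M N : structure) (f : M -> N) (I : set M) (XX : set (set M)).
Context (pa : PA M) (Icut : cut I).
Context (Iadd : closed_under sadd I) (Imul : closed_under smul I).
Context (Mcg : countably_generated_over I) (XXsub : forall X, XX X -> X `<=` I).
Context (ef : elementary f) (fcg : countably_generated f).
Context (IG : GCIS f = I) (codf : Cod_ext_eq f I XX).

(** Both [M] and [N] are countably generated over [I], so countably many families
    indexed by [I] contain all definable sets, and an ultrafilter that treats
    them one after the other has the required ultrapower. *)
Theorem generated_extension : Delta_Def_cut 2 pa Icut Iadd Imul `<=` XX ->
  exists (N' : structure) (e : M -> N'), [/\ cofinal_extension e, Cod_ext_eq e I XX &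
    exists b : N', fills e I b /\ generated_by e b].
Proof.
move=> D2.
have trace_Sigma1 D : Def M D -> exists2 Z, Def N Z &
    forall a, I a -> (Z (f a) <-> exists2 x, I x & D (cpair a x)).
  move=> dD; have [Z dZ hZ] := coded_trace ef codf (D2 _ (Delta2_projection pa Icut Iadd Imul dD)).
  exists Z => // a Ia; apply: iff_trans (iff_sym (hZ a Ia)) _.
  by split=> [[]|].
have I0 : I szero := cut_zero pa Icut.
have Ipair a b : I a -> I b -> I (cpair a b) by exact: cut_cpair.
have [X [cX gX]] := Mcg; have [Y [cY gY]] := fcg.
have [W [dW hW]] := countably_generated_Def pa cX (ex_intro _ _ I0) Ipair gX.
have gN := generates_trans pa ef gX gY.
rewrite image_setU setUA in gN.
have cN : countable (Y `|` f @` X).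
  have -> : Y `|` f @` X = \bigcup_(i in [set: bool]) (if i then Y else f @` X).
    apply/seteqP; split=> [y [] h|y [[] _ h]]; [by exists true | by exists false | by left | by right].
  apply: bigcup_countable => [|[] _ //]; first exact: countableP.
  by apply: sub_countable cX; exact: card_image_le.
have J0 : (f @` I) !=set0 by exists (f szero), szero.
have Jpair a b : (f @` I) a -> (f @` I) b -> (f @` I) (cpair a b).
  move=> [x Ix <-] [y Iy <-]; exists (cpair x y); first exact: Ipair.
  exact: elementary_pair.
have [V [dV hV]] := countably_generated_Def (PA_elementary ef pa) cN J0 Jpair gN.
have [U [U_dec U_meet U_XX XX_U]] :=
  ultrafilter pa ef Icut IG Iadd Imul trace_Sigma1 dW hW dV hV.
exists (ultrapower U), (ultra_embed U); split.
- exact: (ultra_cofinal pa Icut U_dec U_meet).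
- apply: (ultra_Cod pa Icut U_dec U_meet XXsub) => [D /U_XX [T dT hT]|Z hZ].
    have := trace_coded ef codf dT; congr XX; apply/seteqP.
    by split=> i [Ii h]; split=> //; exact/hT.
  have [T /XX_U [D dD hD] hT] := coded_trace ef codf hZ.
  by exists D => // i Ii; rewrite hT // hD.
- exists (ultra_id U); split; first exact: (ultra_fills pa Icut U_dec U_meet).
  exact: (ultra_generated pa Icut U_dec U_meet).
Qed.

End Existence.

Theorem theorem4p1 (M : structure) (I : set M) (XX : set (set M))
    (pa : PA M) (Icut : cut I)
    (Iadd : closed_under sadd I) (Imul : closed_under smul I)
    (Mcg : countably_generated_over I)
    (CodXX : Cod I `<=` XX) (XXsub : forall X, XX X -> X `<=` I)
    (Xext : exists (N : structure) (f : M -> N),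
        countably_generated f /\ X_extension f XX) :
  let P1 := Delta_Def_cut 2 pa Icut Iadd Imul `<=` XX in
  let P2 := exists (N : structure) (f : M -> N),
      [/\ cofinal_extension f, countably_generated f, filling f,
          GCIS f = I & Cod_ext_eq f I XX] in
  let P3 := exists (N : structure) (f : M -> N),
      [/\ cofinal_extension f, Cod_ext_eq f I XX &
          exists b : N, fills f I b /\ generated_by f b] in
  (P1 <-> P2) /\ (P2 <-> P3).
Proof.
move=> P1 P2 P3.
have [N0 [f0 [cg0 [[ef0 _] _ [I' [_ eI' cod0]]]]]] := Xext.
(* The largest member of XX is the cut that it is coded over. *)
have II : I' = I.
  have finj a b : f0 a = f0 b -> a = b := elementary_inj ef0 (x := a) (y := b).
  have Isub : XX I.
    apply: CodXX; exists setT; last by rewrite setIT.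
    rewrite (_ : setT = [set a | a = a]); first by dfn_tac.
    by apply/seteqP; split.
  have I'in : Cod (f0 @` I') (f0 @` I').
    exists setT; last by rewrite setIT.
    rewrite (_ : setT = [set a | a = a]); first by dfn_tac.
    by apply/seteqP; split.
  apply/seteqP; split=> a Ia.
    move: I'in; rewrite cod0 => -[X hX eX].
    have : (f0 @` X) (f0 a) by rewrite eX; exists a.
    by move=> [x Xx /finj <-]; exact: XXsub hX _ Xx.
  have : [set f0 @` X | X in XX] (f0 @` I) by exists I.
  rewrite -cod0 => -[D _ eD].
  have : (f0 @` I) (f0 a) by exists a.
  by rewrite -eD => -[[x Ix /finj <-]].
rewrite II in eI' cod0.
have P13 : P1 -> P3.
  exact: (generated_extension Mcg XXsub ef0 cg0 (esym eI') cod0).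
have P32 : P3 -> P2.
  move=> [N [f [cof cod [b [fb gb]]]]]; exists N, f.
  have IG : GCIS f = I.
    exact: (fills_GCIS pa (proj1 (proj1 cof)) ef0 Icut cod0 (esym eI') cod fb).
  split=> //; last by split=> //; exists b; rewrite IG.
  by exists [set b]; split=> //; rewrite setUC.
have P21 : P2 -> P1.
  move=> [N [f [cof _ [_ [b fb]] IG cod]]]; rewrite IG in fb.
  exact: (filling_Delta2 (proj1 (proj1 cof)) IG cod fb).
tauto.
Qed.
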